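(* Let $\mathcal K$ be a class of connected $L_b$-structures which is closed under isomorphism, such that every member of $\mathcal K$ satisfies VC$^\sharp$, and such that $\mathcal K$ is good for products. Then each structure $\mathbb X\in\langle\mathcal K\rangle$ satisfies VC$^\sharp$. More precisely, if $\mathbb X=\dot\bigcup_{i<n}\prod_{j<m_i}\mathbb X^i_j$ (a disjoint union of finite direct products), where $n\in\mathbb N$, $m_i\in\mathbb N$ for $i<n$, and $\mathbb X^i_j\in\mathcal K$ for all $i<n$, $j<m_i$, then: $I(\mathbb X)\le 1$ if $I(\mathbb X^i_j)\le 1$ for all $i<n$ and $j<m_i$; and $I(\mathbb X)=\mathfrak c$ if $I(\mathbb X^i_j)=\mathfrak c$ for some $i<n$ and $j<m_i$.
   Context: $L_b$ is the first-order language with one binary relation symbol; an $L_b$-structure is $\mathbb X=\langle X,\rho\rangle$ with $X\neq\emptyset$ and $\rho\subseteq X\times X$. $\mathbb X$ is connected iff the smallest equivalence relation on $X$ containing $\rho$ is $X\times X$. $\mathbb N=\{1,2,\dots\}$, $\mathfrak c=2^{\aleph_0}$. For a structure $\mathbb X$, $I(\mathbb X)$ is the number of non-isomorphic countable models of the complete theory $\mathrm{Th}(\mathbb X)$, with the convention that $I(\mathbb X)=0$ iff $\mathrm{Th}(\mathbb X)$ has a finite model (i.e. $\mathbb X$ is finite). $\mathbb X$ satisfies VC$^\sharp$ iff $I(\mathbb X)\in\{0,1,\mathfrak c\}$. Direct products carry the coordinatewise relation. For $\mathbb X_i=\langle X_i,\rho_i\rangle$ with pairwise disjoint domains, the disjoint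 union is $\dot\bigcup_{i}\mathbb X_i=\langle\bigcup_i X_i,\bigcup_i\rho_i\rangle$. $\langle\mathcal K\rangle$ is the smallest class of $L_b$-structures containing $\mathcal K$ and closed under binary direct products and binary disjoint unions (the latter defined for structures with disjoint domains); it is the class of all finite disjoint unions of finite direct products of structures from $\mathcal K$, one-factor products and one-summand unions being allowed. $\mathcal K$ is good for products iff $I(\prod_{i<n}\mathbb X_i)=\mathfrak c$ whenever $n\in\mathbb N$, $\mathbb X_i\in\mathcal K$ for $i<n$, and $I(\mathbb X_i)=\mathfrak c$ for some $i<n$. *)

(* Defs.v *)
From Stdlib Require Export Relation_Operators.
From mathcomp Require Export all_boot.
From mathcomp Require Export boolp classical_sets functions cardinality.

Set Implicit Arguments.
Unset Strict Implicit.
Unset Printing Implicit Defensive.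

Local Open Scope classical_set_scope.
Local Open Scope card_scope.

(** * L_b-structures *)

Record bstruct := BStruct {
  carrier :> Type;
  rel_of : carrier -> carrier -> Prop;
  carrier_inhabited : inhabited carrier }.

Definition iso (X Y : bstruct) : Prop :=
  exists f : X -> Y, bijective f /\
    forall a b : X, rel_of a b <-> rel_of (f a) (f b).

Definition connected_struct (X : bstruct) : Prop :=
  forall a b : X, clos_refl_sym_trans X (@rel_of X) a b.

(** * First-order logic with equality over one binary relation symbol *)

(* [form n] is the type of formulas with free variables among [0, ..., n-1];
   [fEx] binds variable [0] of its body and shifts the others (de Bruijn). *)
Inductive form : nat -> Type :=
| fEq n of 'I_n & 'I_n : form n
| fRel n of 'I_n & 'I_n : form n
| fNot n of form n : form n
| fAnd n of form n & form n : form n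
| fEx n of form n.+1 : form n.

Fixpoint sat (X : bstruct) n (phi : form n) : n.-tuple X -> Prop :=
  match phi in form n return n.-tuple X -> Prop with
  | fEq _ x y => fun v => tnth v x = tnth v y
  | fRel _ x y => fun v => rel_of (tnth v x) (tnth v y)
  | fNot _ p => fun v => ~ sat p v
  | fAnd _ p q => fun v => sat p v /\ sat q v
  | fEx _ p => fun v => exists a : X, sat p [tuple of a :: v]
  end.

Definition sentence := form 0.

Definition holds (X : bstruct) (phi : sentence) : Prop := sat phi [tuple of @nil X].

Definition Th (X : bstruct) : set sentence := [set phi | holds X phi].

Definition is_model (Y : bstruct) (T : set sentence) : Prop :=
  forall phi, T phi -> holds Y phi.

(** * The number of countable models *)

Definition nat_struct (r : nat -> nat -> Prop) : bstruct :=
  BStruct r (inhabits 0).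

(* For a countably infinite [Y], the isomorphism type of [Y], restricted to
   domain [nat]: it is nonempty, and it determines [Y] up to isomorphism. Using
   [set bstruct] instead would be universe-inconsistent with products indexed
   by ['I_n]. *)
Definition iso_type (Y : bstruct) : set (nat -> nat -> Prop) :=
  [set r | iso Y (nat_struct r)].

(* The set of isomorphism types of countable models of [Th X], so that I(X) is
   its cardinality. By convention it is empty when [X] is finite; when [X] is
   infinite, so are all the models of [Th X]. *)
Definition cmodels (X : bstruct) : set (set (nat -> nat -> Prop)) :=
  [set t | infinite_set [set: X] /\
     exists Y : bstruct,
       [/\ countable [set: Y], is_model Y (Th X) & t = iso_type Y]].

Definition continuum : set (nat -> bool) := [set: nat -> bool].

Definition VCsharp (X : bstruct) : Prop :=
  [\/ cmodels X #= `I_0, cmodels X #= `I_1 | cmodels X #= continuum].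

(** * Direct products and disjoint unions *)

Lemma prod_inhabited (X Y : bstruct) : inhabited (X * Y).
Proof.
by case: (carrier_inhabited X) => x; case: (carrier_inhabited Y) => y; split.
Qed.

Definition bprod (X Y : bstruct) : bstruct :=
  @BStruct (X * Y) (fun a b => rel_of a.1 b.1 /\ rel_of a.2 b.2)
    (prod_inhabited X Y).

Lemma sum_inhabited (X Y : bstruct) : inhabited (X + Y).
Proof. by case: (carrier_inhabited X) => x; split; left. Qed.

Definition bsum_rel (X Y : bstruct) (a b : X + Y) : Prop :=
  match a, b with
  | inl x, inl x' => rel_of x x'
  | inr y, inr y' => rel_of y y'
  | _, _ => False
  end.

Definition bsum (X Y : bstruct) : bstruct :=
  BStruct (@bsum_rel X Y) (sum_inhabited X Y).

Lemma bigprod_inhabited n (Xs : 'I_n -> bstruct) :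
  inhabited (forall i, Xs i).
Proof.
split=> i; apply: (projT1 (cid (P := fun _ : Xs i => True) _)).
by case: (carrier_inhabited (Xs i)) => x; exists x.
Qed.

Definition bigprod n (Xs : 'I_n -> bstruct) : bstruct :=
  @BStruct (forall i, Xs i) (fun a b => forall i, rel_of (a i) (b i))
    (bigprod_inhabited Xs).

Lemma bigsum_inhabited n (n_gt0 : 0 < n) (Xs : 'I_n -> bstruct) :
  inhabited {i : 'I_n & Xs i}.
Proof.
by case: (carrier_inhabited (Xs (Ordinal n_gt0))) => x; split; exists (Ordinal n_gt0).
Qed.

Definition bigsum_rel n (Xs : 'I_n -> bstruct) (a b : {i : 'I_n & Xs i}) : Prop :=
  exists (i : 'I_n) (x y : Xs i),
    [/\ a = existT _ i x, b = existT _ i y & rel_of x y].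

Definition bigsum n (n_gt0 : 0 < n) (Xs : 'I_n -> bstruct) : bstruct :=
  BStruct (@bigsum_rel n Xs) (bigsum_inhabited n_gt0 Xs).

(** * Classes of structures *)

Definition iso_closed (K : bstruct -> Prop) : Prop :=
  forall X Y, iso X Y -> K X -> K Y.

(* The sum type is only one copy of the union of two structures with disjoint
   domains; [gen_iso] makes the class independent of the copy chosen. *)
Inductive generated (K : bstruct -> Prop) : bstruct -> Prop :=
| gen_base X : K X -> generated K X
| gen_prod X Y : generated K X -> generated K Y -> generated K (bprod X Y)
| gen_sum X Y : generated K X -> generated K Y -> generated K (bsum X Y)
| gen_iso X Y : iso X Y -> generated K X -> generated K Y.

Definition good_for_products (K : bstruct -> Prop) : Prop :=
  forall (n : nat) (Xs : 'I_n -> bstruct), 0 < n ->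
    (forall i, K (Xs i)) ->
    (exists i, cmodels (Xs i) #= continuum) ->
    cmodels (bigprod Xs) #= continuum.

(* Main.v *)
(** If the theory of [A] has continuum many countable models [M_t], then so has
    the theory of a disjoint union [A + Q], whatever [Q] is. If the map from
    [M_t] to [M_t + Q] is countable-to-one, Koenig's lemma gives continuum many models. Otherwise fix
    [W] isomorphic to [M_t + Q] for uncountably many [t]. Structures are
    determined by the multiplicities of the isomorphism types of their
    components, so the [M_t] in question differ in the multiplicities of
    components that occur infinitely often in [W]. Let [W0] be a countable model
    of the theory of [W] omitting all nonprincipal types realized in [W]. A
    component [D] of [W] that is elementarily equivalent to one occurring
    infinitely often in [W] can be added freely to [W0]; hence if infinitely many
    such [D] have finite multiplicity in [W0], there are continuum many models.
    So up to finitely many exceptions these [D] are infinitely repeated in [W0],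
    which makes all types realized in copies of [D] principal, and then the
    multiplicity of [D] in [M_t] is determined by the theory of [A]: a
    contradiction with the uncountable choice of [t].

    If all factors have at most one countable model, they realize finitely many
    [n]-types for each [n] (omitting types), a property preserved by products and
    sums and equivalent to uniqueness of the countable model. *)

Require Import Defs.
From mathcomp Require Import zify.
From mathcomp Require Import filter.

Set Implicit Arguments.
Unset Strict Implicit.
Unset Printing Implicit Defensive.

Local Open Scope classical_set_scope.
Local Open Scope card_scope.

(** * Finite-rank types *)

(** Two kinds of back-and-forth systems compare structures. Global ones give elementary equivalence
    and, between countable structures, isomorphism. Local ones move only inside the components
    already met, so they do not notice what the rest of the structure is. A local system extends to
    a global one once both structures contain every component equally often. Elementary equivalence
    alone does not equate these multiplicities, but it does between ultrapowers, which are
    saturated. Hence locally equivalent tuples of elementarily equivalent structures have the same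
    type; this is how types are carried between copies of a component lying in different structures.
    Components are compared up to potential isomorphism because ultrapowers are in general
    uncountable.

    When many [M_t + Q] are isomorphic to one [W], the copies of a component lying outside [M_t] are
    those in [Q], equally many for all [t]. If they are finitely many, subtraction gives the
    multiplicity in [M_t]. Only components repeated infinitely often in [Q] need the theory, and the
    finitely many exceptions leave countably many possibilities for their multiplicities. *)

Definition scons X (a : X) (e : nat -> X) : nat -> X :=
  fun i => if i is j.+1 then e j else a.
Notation "a .: e" := (scons a e) (at level 60, right associativity).

Fixpoint htype (k n : nat) : finType :=
  if k is k'.+1 then {set htype k' n.+1} else {ffun 'I_n * 'I_n -> bool * bool}.

(* The type of quantifier rank [k] of the tuple [e 0, ..., e n.-1]; the values of
   [e] from [n] on are irrelevant. As codes live in a finite type, they play the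
   role of the finitely many formulas of rank [k] up to equivalence. *)
Fixpoint code (X : bstruct) k n (e : nat -> X) : htype k n :=
  match k return htype k n with
  | 0 => [ffun p : 'I_n * 'I_n => (`[< e p.1 = e p.2 >], `[< rel_of (e p.1) (e p.2) >])]
  | k'.+1 => finset (fun t => `[< exists x, code k' n.+1 (x .: e) = t >])
  end.

Definition tpeq (X Y : bstruct) n (e : nat -> X) (e' : nat -> Y) : Prop :=
  forall k, code k n e = code k n e'.

Definition pt (X : bstruct) : X :=
  projT1 (cid (let: inhabits x := carrier_inhabited X in
               ex_intro (fun _ : X => True) x I)).

Definition elemeq (X Y : bstruct) : Prop :=
  @tpeq X Y 0 (fun=> pt X) (fun=> pt Y).

Lemma code0P (X Y : bstruct) n (e : nat -> X) (e' : nat -> Y) :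
  code 0 n e = code 0 n e' <->
  forall i j, i < n -> j < n ->
    (e i = e j <-> e' i = e' j) /\ (rel_of (e i) (e j) <-> rel_of (e' i) (e' j)).
Proof.
split=> [/ffunP H i j ltin ltjn | H].
  have := H (Ordinal ltin, Ordinal ltjn); rewrite !ffunE /= => -[H1 H2].
  split; split=> /asboolP; first [rewrite H1 | rewrite -H1 | rewrite H2 | rewrite -H2];
    by move/asboolP.
apply/ffunP => -[[i ltin] [j ltjn]]; rewrite !ffunE /=.
by have [E R] := H i j ltin ltjn; congr pair; apply: asbool_equiv_eq.
Qed.

Lemma codeSP (X Y : bstruct) k n (e : nat -> X) (e' : nat -> Y) :
  code k.+1 n e = code k.+1 n e' <->
  (forall x, exists y, code k n.+1 (x .: e) = code k n.+1 (y .: e')) /\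
  (forall y, exists x, code k n.+1 (x .: e) = code k n.+1 (y .: e')).
Proof.
split=> [/setP H | [H1 H2]].
  split=> [x | y].
    have := H (code k n.+1 (x .: e)); rewrite !inE.
    have -> : `[< exists x0, code k n.+1 (x0 .: e) = code k n.+1 (x .: e) >]
      by apply/asboolP; exists x.
    by move/esym/asboolP => [y Hy]; exists y.
  have := H (code k n.+1 (y .: e')); rewrite !inE.
  have -> : `[< exists y0, code k n.+1 (y0 .: e') = code k n.+1 (y .: e') >]
    by apply/asboolP; exists y.
  by move/asboolP => [x Hx]; exists x.
apply/setP => t; rewrite !inE; apply: asbool_equiv_eq; split=> -[x <-].
  by have [y Hy] := H1 x; exists y.
by have [y Hy] := H2 x; exists y.
Qed.

(** The same substitution of positions reads both short tuples off the long ones, and moves extend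
    it by one position. This one statement covers permuting, repeating and dropping entries. *)
Lemma code_sub (X Y : bstruct) k m n (e : nat -> X) (e' : nat -> Y) f f' :
  (forall i, i < n -> exists j, [/\ j < m, f i = e j & f' i = e' j]) ->
  code k m e = code k m e' -> code k n f = code k n f'.
Proof.
elim: k m n e e' f f' => [|k IHk] m n e e' f f' sub.
  move=> /code0P H; apply/code0P => i j ltin ltjn.
  have [i' [lti' -> ->]] := sub i ltin; have [j' [ltj' -> ->]] := sub j ltjn.
  exact: H.
have sub' x y i : i < n.+1 -> exists j,
    [/\ j < m.+1, (x .: f) i = (x .: e) j & (y .: f') i = (y .: e') j].
  case: i => [|i] lti; first by exists 0.
  by have [j [ltj E E']] := sub i lti; exists j.+1.
move=> /codeSP[H1 H2]; apply/codeSP; split=> [x | y].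
  by have [y Hy] := H1 x; exists y; apply: IHk Hy => i; apply: sub'.
by have [x Hx] := H2 y; exists x; apply: IHk Hx => i; apply: sub'.
Qed.

Lemma code_ext (X : bstruct) k n (e f : nat -> X) :
  (forall i, i < n -> e i = f i) -> code k n e = code k n f.
Proof.
move=> ef; apply: (@code_sub X X k n n e e) => // i ltin.
by exists i; split=> //; rewrite ef.
Qed.

Lemma code_drop (X Y : bstruct) k n (e : nat -> X) (e' : nat -> Y) x y :
  code k n.+1 (x .: e) = code k n.+1 (y .: e') -> code k n e = code k n e'.
Proof. by apply: code_sub => i ltin; exists i.+1. Qed.

Lemma codeW (X Y : bstruct) k n (e : nat -> X) (e' : nat -> Y) :
  code k.+1 n e = code k.+1 n e' -> code k n e = code k n e'.
Proof. by move=> /codeSP[/(_ (pt X))[y Hy] _]; apply: code_drop Hy. Qed.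

Lemma code_le (X Y : bstruct) j k n (e : nat -> X) (e' : nat -> Y) :
  j <= k -> code k n e = code k n e' -> code j n e = code j n e'.
Proof.
by move/subnK <-; elim: (k - j) => // d IHd; rewrite addSn => /codeW.
Qed.

Lemma tpeq_sub (X Y : bstruct) m n (e : nat -> X) (e' : nat -> Y) f f' :
  (forall i, i < n -> exists j, [/\ j < m, f i = e j & f' i = e' j]) ->
  tpeq m e e' -> tpeq n f f'.
Proof. by move=> H T k; apply: code_sub (T k). Qed.

Lemma tpeq_sym (X Y : bstruct) n (e : nat -> X) (e' : nat -> Y) :
  tpeq n e e' -> tpeq n e' e.
Proof. by move=> H k. Qed.

Lemma tpeq_trans (X Y Z : bstruct) n (e : nat -> X) (e' : nat -> Y) (e'' : nat -> Z) :
  tpeq n e e' -> tpeq n e' e'' -> tpeq n e e''.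
Proof. by move=> H H' k; rewrite H. Qed.

Lemma tpeqP (X Y : bstruct) n (e : nat -> X) (e' : nat -> Y) i j :
  tpeq n e e' -> i < n -> j < n ->
    (e i = e j <-> e' i = e' j) /\ (rel_of (e i) (e j) <-> rel_of (e' i) (e' j)).
Proof. by move=> /(_ 0)/code0P H ltin ltjn; apply: H. Qed.

Lemma elemeq_code (X Y : bstruct) k (e : nat -> X) (e' : nat -> Y) :
  elemeq X Y -> code k 0 e = code k 0 e'.
Proof.
move=> /(_ k) H; rewrite (@code_ext X k 0 e (fun=> pt X)) // H.
exact: code_ext.
Qed.

Lemma elemeq_refl X : elemeq X X. Proof. by []. Qed.

Lemma elemeq_sym X Y : elemeq X Y -> elemeq Y X.
Proof. exact: tpeq_sym. Qed.

Lemma elemeq_trans X Y Z : elemeq X Y -> elemeq Y Z -> elemeq X Z.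
Proof. exact: tpeq_trans. Qed.

(* [n] moves of the back-and-forth game. *)
Lemma code_cat (X Y : bstruct) k m n (e : nat -> X) (e' : nat -> Y) (c : nat -> X) :
  code (k + n) m e = code (k + n) m e' ->
  exists d : nat -> Y,
    code k (n + m) (fun i => if i < n then c i else e (i - n)) =
    code k (n + m) (fun i => if i < n then d i else e' (i - n)).
Proof.
elim: n k => [|n IHn] k.
  by rewrite addn0 => H; exists (fun=> pt Y); apply: code_sub H => i lti; exists i;
     rewrite subn0.
rewrite addnS -addSn => /IHn[d /codeSP[/(_ (c n))[y Hy] _]].
exists (fun i => if i < n then d i else y).
rewrite addSn; apply: code_sub Hy => i lti.
have [ltin | lein] := ltnP i n.
  by exists i.+1; rewrite /= ltin (ltn_trans ltin) //; split=> //; lia.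
move: lein; rewrite leq_eqVlt => /orP[/eqP <- | ltni].
  by exists 0; rewrite ltnSn; split=> //; lia.
exists i => /=; case: i lti ltni => //= i lti ltni.
have -> : i.+1 < n.+1 = false by lia.
have -> : i < n = false by lia.
by rewrite subSS.
Qed.

Lemma elemeq_ex (X Y : bstruct) k n (c : nat -> X) :
  elemeq X Y -> exists d : nat -> Y, code k n c = code k n d.
Proof.
move=> XY.
have [d Hd] := @code_cat X Y k 0 n c (fun=> pt Y) c (elemeq_code _ _ _ XY).
exists d; apply: code_sub Hd => i lti; exists i.
by rewrite addn0 lti.
Qed.

Lemma elemeq_of_tpeq (X Y : bstruct) n (e : nat -> X) (e' : nat -> Y) :
  tpeq n e e' -> elemeq X Y.
Proof. by apply: tpeq_sub. Qed.

Lemma nth_cons_scons (X : Type) (x0 a : X) s : nth x0 (a :: s) = (a .: nth x0 s).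
Proof. by apply/funext => -[]. Qed.

(** The rank is the quantifier depth: [fEx] costs one, the other connectives nothing. *)
Lemma sat_code n (phi : form n) : exists k, forall (X Y : bstruct)
  (v : n.-tuple X) (w : n.-tuple Y) x0 y0,
  code k n (nth x0 v) = code k n (nth y0 w) -> (sat phi v <-> sat phi w).
Proof.
elim: n / phi => [n x y | n x y | n p [k IH] | n p [k IHp] q [l IHq] | n p [k IH]].
- exists 0 => X Y v w x0 y0 /code0P/(_ x y (ltn_ord _) (ltn_ord _))[H _] /=.
  by rewrite !(tnth_nth x0) !(tnth_nth y0).
- exists 0 => X Y v w x0 y0 /code0P/(_ x y (ltn_ord _) (ltn_ord _))[_ H] /=.
  by rewrite !(tnth_nth x0) !(tnth_nth y0).
- by exists k => X Y v w x0 y0 /IH /= H; split=> + /H.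
- exists (maxn k l) => X Y v w x0 y0 H /=.
  have Hp := IHp _ _ _ _ _ _ (code_le (leq_maxl _ _) H).
  have Hq := IHq _ _ _ _ _ _ (code_le (leq_maxr _ _) H).
  by split=> -[/Hp ? /Hq].
exists k.+1 => X Y v w x0 y0 /codeSP[H1 H2] /=; split=> -[a Ha].
  have [b] := H1 a; rewrite -!nth_cons_scons => Hb; exists b.
  by apply/(IH _ _ [tuple of a :: v] [tuple of b :: w] x0 y0 Hb).
have [b] := H2 a; rewrite -!nth_cons_scons => Hb; exists b.
by apply/(IH _ _ [tuple of b :: v] [tuple of a :: w] x0 y0 Hb).
Qed.

Lemma form_true n : exists phi : form n, forall (X : bstruct) (v : n.-tuple X), sat phi v.
Proof.
by exists (fEx (fEq ord0 ord0)) => X v; exists (pt X).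
Qed.

Lemma form_all n (T : finType) (P : T -> form n) : exists phi : form n,
  forall (X : bstruct) (v : n.-tuple X), sat phi v <-> forall t, sat (P t) v.
Proof.
suff [phi H] : exists phi : form n, forall (X : bstruct) (v : n.-tuple X),
    sat phi v <-> forall t, t \in enum T -> sat (P t) v.
  exists phi => X v; rewrite H; split=> Ht t; last by move=> _; apply: Ht.
  by apply: Ht; rewrite mem_enum.
elim: (enum T) => [|t s [phi IH]].
  by have [phi H] := form_true n; exists phi => X v; split.
exists (fAnd (P t) phi) => X v /=; rewrite IH; split=> [[Pt Ps] u | H].
  by rewrite in_cons => /orP[/eqP -> | /Ps].
by split=> [|u us]; apply: H; rewrite in_cons ?eqxx // us orbT.
Qed.

Definition fbool n (b : bool) (p : form n) : form n := if b then p else fNot p.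

Lemma sat_fbool n b (p : form n) (X : bstruct) (v : n.-tuple X) :
  sat (fbool b p) v <-> (`[< sat p v >] = b).
Proof.
case: b => /=; first by split=> [?|/asboolP//]; apply/asboolP.
by split=> [? | /asboolP//]; apply/asboolP.
Qed.

(** As [htype] is finite, a code of rank [k.+1] is described by a finite conjunction saying of each
    code of rank [k] whether some further element attains it. *)
Lemma hintikka_formula k n (t : htype k n) : exists phi : form n,
  forall (X : bstruct) (v : n.-tuple X) x0, sat phi v <-> code k n (nth x0 v) = t.
Proof.
elim: k n t => [|k IHk] n t.
  have [phi H] := form_all (fun p : 'I_n * 'I_n =>
    fAnd (fbool (t p).1 (fEq p.1 p.2)) (fbool (t p).2 (fRel p.1 p.2))).
  exists phi => X v x0; rewrite H; split=> [Ht | <-].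
    apply/ffunP => p; have [/sat_fbool H1 /sat_fbool H2] := Ht p.
    by rewrite ffunE [RHS]surjective_pairing -H1 -H2 /= !(tnth_nth x0).
  by move=> p; split; apply/sat_fbool; rewrite ffunE /= !(tnth_nth x0).
pose P (u : htype k n.+1) := projT1 (cid (IHk n.+1 u)).
have PP u : forall (X : bstruct) (v : n.+1.-tuple X) x0,
    sat (P u) v <-> code k n.+1 (nth x0 v) = u by rewrite /P; case: cid.
have [phi H] := form_all (fun u => fbool (u \in t) (fEx (P u))).
exists phi => X v x0; rewrite H.
have E u : sat (fEx (P u)) v <-> exists x, code k n.+1 (x .: nth x0 v) = u.
  by split=> /= -[x Hx]; exists x; move: Hx; rewrite (PP _ _ _ x0) -nth_cons_scons.
split=> [Ht | <- u]; last first.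
  by apply/sat_fbool; rewrite inE; apply: asbool_equiv_eq.
apply/setP => u; rewrite inE; have /sat_fbool <- := Ht u.
by apply: asbool_equiv_eq; symmetry.
Qed.

Lemma modelP (X Y : bstruct) : is_model Y (Th X) <-> elemeq X Y.
Proof.
split=> [H k | H phi].
  have [phi P] := hintikka_formula (code k 0 (fun=> pt X)).
  have E (Z : bstruct) : holds Z phi <-> code k 0 (fun=> pt Z) = code k 0 (fun=> pt X).
    rewrite /holds (P _ _ (pt Z)); rewrite (@code_ext Z k 0 _ (fun=> pt Z)) //.
  by symmetry; apply/E; apply: H; apply/E.
rewrite /Th /= /holds; have [k P] := sat_code phi.
by apply: (proj1 (P X Y _ _ (pt X) (pt Y) _)); apply: elemeq_code.
Qed.

(** * Ultrapowers *)

Lemma nat_ultrafilter : exists ultra : set_system nat, UltraFilter ultra /\ \oo `<=` ultra.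
Proof. exact: ultraFilterLemma. Qed.

Definition ultra : set_system nat := projT1 (cid nat_ultrafilter).

#[local] Instance ultra_ultrafilter : UltraFilter ultra.
Proof. by rewrite /ultra; case: cid => ? []. Qed.

#[local] Instance ultra_filter : Filter ultra.
Proof. exact: filter_filter. Qed.

Lemma ultra_ge n : ultra [set i | n <= i].
Proof.
rewrite /ultra; case: cid => V /= [_]; apply; exists n => //.
Qed.

Lemma ultra_mono (P Q : nat -> Prop) : ultra P -> (forall i, P i -> Q i) -> ultra Q.
Proof. by move=> UP PQ; apply: filterS UP. Qed.

Lemma ultra_and (P Q : nat -> Prop) : ultra P -> ultra Q -> ultra (fun i => P i /\ Q i).
Proof. exact: filterI. Qed.

Lemma ultra_all (P : nat -> Prop) : (forall i, P i) -> ultra P.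
Proof. by move=> HP; apply: filterS filterT. Qed.

Lemma ultra_ex (P : nat -> Prop) : ultra P -> exists i, P i.
Proof. exact: filter_ex. Qed.

Lemma ultra_dec (P : nat -> Prop) : ultra P \/ ultra (fun i => ~ P i).
Proof. exact: in_ultra_setVsetC. Qed.

Lemma ultra_not (P : nat -> Prop) : ultra (fun i => ~ P i) <-> ~ ultra P.
Proof.
split=> [H1 H2 | H]; last by case: (ultra_dec P).
by have [i [? ?]] := ultra_ex (ultra_and H1 H2).
Qed.

Lemma ultra_lim (T : finType) (f : nat -> T) : exists t, ultra (fun i => f i = t).
Proof.
apply: contrapT => H.
suff: ultra (fun i => forall t, t \in enum T -> f i <> t).
  by move=> /ultra_ex[i /(_ (f i))]; rewrite mem_enum => /(_ isT).
elim: (enum T) => [|t s IH]; first exact: ultra_all.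
have /ultra_not Ht : ~ ultra (fun i => f i = t) by move=> ?; apply: H; exists t.
apply: (ultra_mono (ultra_and Ht IH)) => i [/= ? Hs] t'.
by rewrite in_cons => /orP[/eqP ->|/Hs].
Qed.

Definition ueq (X : Type) (f g : nat -> X) : Prop := ultra (fun i => f i = g i).

Lemma ueq_refl (X : Type) (f : nat -> X) : ueq f f.
Proof. exact: ultra_all. Qed.

Definition ucar (X : Type) := {A : (nat -> X) -> Prop | exists f, A = ueq f}.

Definition cls (X : Type) (f : nat -> X) : ucar X :=
  exist (fun A => exists f, A = ueq f) (ueq f) (ex_intro _ f erefl).

Definition rep (X : Type) (a : ucar X) : nat -> X := projT1 (cid (proj2_sig a)).

Lemma repK (X : Type) (a : ucar X) : cls (rep a) = a.
Proof.
case: a => A fA; rewrite /rep /=; case: cid => f /= E; subst A.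
by congr exist; apply: Prop_irrelevance.
Qed.

Lemma clsP (X : Type) (f g : nat -> X) : cls f = cls g <-> ultra (fun i => f i = g i).
Proof.
split=> [/(congr1 (fun a => proj1_sig a g)) /= E | fg].
  by rewrite -[ultra _]/(ueq f g) E; apply: ueq_refl.
have E : ueq f = ueq g.
  apply/funext => h; apply/propext; split; move=> H; apply: (ultra_mono (ultra_and fg H)) => i /=;
  by case=> -> ->.
rewrite /cls; move: (ex_intro _ f _) (ex_intro _ g _); rewrite E => p q.
by congr exist; apply: Prop_irrelevance.
Qed.

Lemma rep_cls (X : Type) (f : nat -> X) : ultra (fun i => rep (cls f) i = f i).
Proof. by apply/clsP; rewrite repK. Qed.

Lemma ucar_inhabited (X : bstruct) : inhabited (ucar X).
Proof. by split; apply: (cls (fun=> pt X)). Qed.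

Definition upow (X : bstruct) : bstruct :=
  @BStruct (ucar X) (fun a b => ultra (fun i => rel_of (rep a i) (rep b i)))
    (ucar_inhabited X).

Lemma cls_rel (X : bstruct) (f g : nat -> X) :
  @rel_of (upow X) (cls f) (cls g) <-> ultra (fun i => rel_of (f i) (g i)).
Proof.
have H : ultra (fun i => rep (cls f) i = f i /\ rep (cls g) i = g i).
  exact: ultra_and (rep_cls f) (rep_cls g).
rewrite /rel_of /=; split=> K.
  by have HK := ultra_and H K; apply: (ultra_mono HK) => i [[-> ->]].
by have HK := ultra_and H K; apply: (ultra_mono HK) => i [[-> ->]].
Qed.

(** A code has finitely many possible values, so the ultrafilter settles on one of them; therefore
    only the implication from the coordinates to the ultrapower requires induction. *)
Lemma los (X : bstruct) k n (f : nat -> nat -> X) t :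
  code k n (fun j => cls (f j) : upow X) = t <->
  ultra (fun i => code k n (fun j => f j i) = t).
Proof.
suff H t' : ultra (fun i => code k n (fun j => f j i) = t') ->
    code k n (fun j => cls (f j) : upow X) = t'.
  split; last exact: H.
  have [t' Ht'] := ultra_lim (fun i => code k n (fun j => f j i)).
  by rewrite (H _ Ht') => <-.
elim: k n f {t} t' => [|k IHk] n f t Ht.
  apply/ffunP => -[i j]; rewrite ffunE [RHS]surjective_pairing /=.
  have {}Ht : ultra (fun l => `[< f i l = f j l >] = (t (i, j)).1 /\
                          `[< rel_of (f i l) (f j l) >] = (t (i, j)).2).
    by apply: (ultra_mono Ht) => l /= <-; rewrite ffunE.
  congr pair.
    case E : (t (i, j)).1 Ht => Ht.
      by apply/asboolP/clsP; apply: (ultra_mono Ht) => l [/asboolP].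
    apply/asboolPn => /clsP; apply/ultra_not.
    by apply: (ultra_mono Ht) => l [/asboolPn].
  case E : (t (i, j)).2 Ht => Ht.
    by apply/asboolP/cls_rel; apply: (ultra_mono Ht) => l [_ /asboolP].
  apply/asboolPn => /cls_rel; apply/ultra_not.
  by apply: (ultra_mono Ht) => l [_ /asboolPn].
have scE (g : nat -> X) i : (fun j => (g .: f) j i) = (g i .: fun j => f j i).
  by apply/funext => -[].
have scC (g : nat -> X) : (fun j => cls ((g .: f) j)) = (cls g .: fun j => cls (f j)).
  by apply/funext => -[].
apply/setP => t'; rewrite inE; apply/asboolP/idP => [[x] | t't].
  rewrite -[x]repK -scC => Hx.
  have [t'' Ht''] := ultra_lim (fun i => code k n.+1 (fun j => (rep x .: f) j i)).
  have E : t'' = t' by rewrite -Hx; symmetry; apply: IHk.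
  have [i [/= Hi <-]] := ultra_ex (ultra_and Ht'' Ht).
  by rewrite inE -E -Hi scE; apply/asboolP; exists (rep x i).
have /choice[g Hg] i : exists x : X, code k.+1 n (fun j => f j i) = t ->
    code k n.+1 (x .: fun j => f j i) = t'.
  have [Hi | ?] := pselect (code k.+1 n (fun j => f j i) = t); last by exists (pt X).
  by move: t't; rewrite -Hi inE => /asboolP[x Hx]; exists x.
exists (cls g); rewrite -scC; apply: IHk.
by apply: (ultra_mono Ht) => i /Hg; rewrite scE.
Qed.

Lemma los_env (X : bstruct) k n (e : nat -> upow X) :
  ultra (fun i => code k n (fun j => rep (e j) i) = code k n e).
Proof.
apply/los; congr code; apply/funext => j; exact: repK.
Qed.

Lemma los_const (X : bstruct) n (e : nat -> X) :
  tpeq n (fun j => cls (fun=> e j) : upow X) e.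
Proof. by move=> k; apply/los; apply: ultra_all. Qed.

Lemma elemeq_upow (X : bstruct) : elemeq (upow X) X.
Proof. exact: elemeq_of_tpeq (@los_const X 0 (fun=> pt X)). Qed.

(** At coordinate [i], choose an element for the strongest satisfiable condition among [P 0 i], ...,
    [P i i]. Condition [k] then holds at almost all coordinates from [k] on. *)
Lemma ultra_diag (X : bstruct) (P : nat -> nat -> X -> Prop) :
  (forall k, ultra (fun i => exists x, P k i x)) ->
  (forall j k i x, j <= k -> P k i x -> P j i x) ->
  exists f : nat -> X, forall k, ultra (fun i => P k i (f i)).
Proof.
move=> HP Pmono.
have /choice[f Hf] i : exists x, forall k, k <= i -> (exists x, P k i x) -> P k i x.
  have : exists x, forall k, k < i.+1 -> (exists x', P k i x') -> P k i x.
    elim: i.+1 => [|m [x IH]]; first by exists (pt X).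
    have [[y Py] | nP] := pselect (exists y, P m i y).
      by exists y => k ltk _; apply: Pmono Py.
    exists x => k; rewrite ltnS leq_eqVlt => /orP[/eqP -> /nP // | ]; exact: IH.
  done.
exists f => k; apply: (ultra_mono (ultra_and (ultra_ge k) (HP k))) => i [/= ? ?].
exact: Hf.
Qed.

(** Countably many ranks have to be matched, each of them can be matched at almost all coordinates,
    and higher ranks imply lower ones: this is the situation of [ultra_diag]. *)
Lemma upow_saturated (X Y : bstruct) n (e : nat -> upow X) (e' : nat -> Y) :
  tpeq n e e' -> forall y, exists x, tpeq n.+1 (x .: e) (y .: e').
Proof.
move=> ee' y.
have [||f Hf] := @ultra_diag X (fun k i x =>
  code k n.+1 (x .: fun j => rep (e j) i) = code k n.+1 (y .: e')).
- move=> k; have /codeSP[_ /(_ y)[x Hx]] := ee' k.+1.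
  apply: (ultra_mono (los_env k n.+1 (x .: e))) => i; rewrite Hx => Hi.
  by exists (rep x i); rewrite -Hi; congr code; apply/funext => -[].
- by move=> j k i x /code_le; apply.
exists (cls f) => k.
have -> : (cls f .: e) = (fun j => cls ((f .: fun j => rep (e j)) j)).
  by apply/funext => -[|j] //=; rewrite repK.
apply/los; apply: (ultra_mono (Hf k)) => i <-.
by congr code; apply/funext => -[].
Qed.

(** * Potential isomorphism *)

Definition bfsys (X Y : bstruct) (B : nat -> (nat -> X) -> (nat -> Y) -> Prop) :=
  forall n e e', B n e e' ->
    [/\ code 0 n e = code 0 n e', forall x, exists y, B n.+1 (x .: e) (y .: e')
      & forall y, exists x, B n.+1 (x .: e) (y .: e')].

(* Potential isomorphism of [X] and [Y] extending the pairs [(e i, e' i)], [i < n]. *)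
Definition pi (X Y : bstruct) n (e : nat -> X) (e' : nat -> Y) : Prop :=
  exists B, bfsys B /\ B n e e'.

Lemma pi_bfsys (X Y : bstruct) : bfsys (@pi X Y).
Proof.
move=> n e e' [B [HB Bee']]; have [H0 H1 H2] := HB _ _ _ Bee'.
split=> // [x|y]; first by have [y By] := H1 x; exists y, B.
by have [x Bx] := H2 y; exists x, B.
Qed.

Lemma pi_tpeq (X Y : bstruct) n (e : nat -> X) (e' : nat -> Y) : pi n e e' -> tpeq n e e'.
Proof.
move=> + k; elim: k n e e' => [|k IHk] n e e' /pi_bfsys[H0 H1 H2] //.
apply/codeSP; split=> [x | y].
  by have [y /IHk Hy] := H1 x; exists y.
by have [x /IHk Hx] := H2 y; exists x.
Qed.

(** Saturation on both sides makes equality of types itself a back-and-forth system. *)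
Lemma pi_upow (X Y : bstruct) n (e : nat -> upow X) (e' : nat -> upow Y) :
  tpeq n e e' -> pi n e e'.
Proof.
move=> ee'; exists (fun n e e' => tpeq n e e'); split=> // m f f' ff'; split=> // [x|y].
  by have [y /tpeq_sym Hy] := upow_saturated (tpeq_sym ff') x; exists y.
exact: upow_saturated.
Qed.

(** * Components and local back-and-forth systems *)

Definition edge (X : bstruct) (x y : X) : Prop := rel_of x y \/ rel_of y x.

Fixpoint connN (X : bstruct) d (x y : X) : Prop :=
  if d is d'.+1 then exists z, connN d' x z /\ edge z y else x = y.

Definition conn (X : bstruct) (x y : X) : Prop := exists d, connN d x y.

Lemma edge_sym (X : bstruct) (x y : X) : edge x y -> edge y x.
Proof. by rewrite /edge; tauto. Qed.

Lemma conn_refl (X : bstruct) (x : X) : conn x x.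
Proof. by exists 0. Qed.

Lemma conn_edge (X : bstruct) (x y z : X) : conn x y -> edge y z -> conn x z.
Proof. by move=> [d xy] yz; exists d.+1, y. Qed.

Lemma conn_trans (X : bstruct) (x y z : X) : conn x y -> conn y z -> conn x z.
Proof.
move=> xy [d]; elim: d z => [|d IHd] z /=; first by move<-.
by move=> [u [/IHd ? ?]]; apply: conn_edge; eauto.
Qed.

Lemma conn_sym (X : bstruct) (x y : X) : conn x y -> conn y x.
Proof.
move=> [d]; elim: d y => [|d IHd] y /=; first by move->; apply: conn_refl.
move=> [u [/IHd ux uy]]; apply: conn_trans ux.
exact: (conn_edge (conn_refl _) (edge_sym uy)).
Qed.

Lemma code0_edge (X Y : bstruct) n (e : nat -> X) (e' : nat -> Y) i j :
  code 0 n e = code 0 n e' -> i < n -> j < n -> edge (e i) (e j) -> edge (e' i) (e' j).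
Proof.
move=> /code0P H ltin ltjn.
by case=> /(proj2 (H _ _ _ _)); [left | right]; auto.
Qed.

(** Each step of the path is one move and costs one rank. *)
Lemma code_reach (X Y : bstruct) k d n (e : nat -> X) (e' : nat -> Y) i c :
  i < n -> connN d (e i) c -> code (k + d) n e = code (k + d) n e' ->
  exists c', connN d (e' i) c' /\ code k n.+1 (c .: e) = code k n.+1 (c' .: e').
Proof.
move=> ltin; elim: d k c => [|d IHd] k c /=.
  rewrite addn0 => <- H; exists (e' i); split=> //.
  by apply: code_sub H => -[|j] ltj; [exists i | exists j].
move=> [u [iu uc]]; rewrite addnS -addSn => /(IHd _ _ iu)[u' [iu' Hu]].
have /codeSP[/(_ c)[c' Hc] _] := Hu; exists c'; split; last first.
  by apply: code_sub Hc => -[|j] ltj; [exists 0 | exists j.+2].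
exists u'; split=> //.
exact: (@code0_edge _ _ _ _ _ 1 0 (code_le (leq0n _) Hc)).
Qed.

Lemma tpeq_conn (X Y : bstruct) n (e : nat -> X) (e' : nat -> Y) i j :
  tpeq n e e' -> i < n -> j < n -> conn (e i) (e j) -> conn (e' i) (e' j).
Proof.
move=> H ltin ltjn [d /(@code_reach X Y 0 d n e e' i _ ltin)/(_ (H _))[c' [Hd]]].
move=> /code0P/(_ 0 j.+1 isT ltjn) [[/(_ erefl) /= E _] _].
by exists d; rewrite -E.
Qed.

(* As [bfsys], except that a move must be adjacent to an earlier one; such a
   system only sees the components of the points it starts from. *)
Definition lpisys (X Y : bstruct) (B : nat -> (nat -> X) -> (nat -> Y) -> Prop) :=
  forall n e e', B n e e' ->
    [/\ code 0 n e = code 0 n e',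
        forall i x, i < n -> edge (e i) x -> exists y, B n.+1 (x .: e) (y .: e')
      & forall i y, i < n -> edge (e' i) y -> exists x, B n.+1 (x .: e) (y .: e')].

Definition lpi (X Y : bstruct) n (e : nat -> X) (e' : nat -> Y) : Prop :=
  exists B, lpisys B /\ B n e e'.

Lemma lpi_lpisys (X Y : bstruct) : lpisys (@lpi X Y).
Proof.
move=> n e e' [B [HB Bee']]; have [H0 H1 H2] := HB _ _ _ Bee'.
split=> // [i x ltin ix|i y ltin iy].
  by have [y By] := H1 i x ltin ix; exists y, B.
by have [x Bx] := H2 i y ltin iy; exists x, B.
Qed.

Lemma lpi_refl (X : bstruct) n (e : nat -> X) : lpi n e e.
Proof.
exists (fun n e e' => e = e'); split=> // m f _ <-.
by split=> // [i x _ _|i y _ _]; [exists x | exists y].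
Qed.

Lemma lpi_sym (X Y : bstruct) n (e : nat -> X) (e' : nat -> Y) :
  lpi n e e' -> lpi n e' e.
Proof.
move=> ee'; exists (fun n (e' : nat -> Y) (e : nat -> X) => lpi n e e').
split=> // m f' f /lpi_lpisys[H0 H1 H2].
by split.
Qed.

Lemma lpi_trans (X Y Z : bstruct) n (e : nat -> X) (e' : nat -> Y) (e'' : nat -> Z) :
  lpi n e e' -> lpi n e' e'' -> lpi n e e''.
Proof.
move=> H H'; exists (fun n (e : nat -> X) (e'' : nat -> Z) =>
  exists e' : nat -> Y, lpi n e e' /\ lpi n e' e'').
split=> [m f g|]; last by exists e'.
move=> [h [/lpi_lpisys[H0 H1 H2] /lpi_lpisys[H0' H1' H2']]].
split=> [|i x ltin ix|i z ltin iz]; first by rewrite H0.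
  have [y Hy] := H1 i x ltin ix; have /lpi_lpisys[Hy0 _ _] := Hy.
  have iy : edge (h i) y by apply: (@code0_edge _ _ _ _ _ i.+1 0 Hy0).
  by have [z Hz] := H1' i y ltin iy; exists z, (y .: h).
have [y Hy] := H2' i z ltin iz; have /lpi_lpisys[Hy0 _ _] := Hy.
have iy : edge (h i) y by apply: (@code0_edge _ _ _ _ _ i.+1 0 (esym Hy0)).
by have [x Hx] := H2 i y ltin iy; exists x, (y .: h).
Qed.

Lemma lpi_sub (X Y : bstruct) m n (e : nat -> X) (e' : nat -> Y) f f' :
  (forall i, i < n -> exists j, [/\ j < m, f i = e j & f' i = e' j]) ->
  lpi m e e' -> lpi n f f'.
Proof.
move=> sub H; exists (fun n (f : nat -> X) (f' : nat -> Y) =>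
  exists m (e : nat -> X) (e' : nat -> Y), lpi m e e' /\
  forall i, i < n -> exists j, [/\ j < m, f i = e j & f' i = e' j]).
split=> [l g g'|]; last by exists m, e, e'.
move=> {m n e e' f f' H sub}[m [e [e' [/lpi_lpisys[H0 H1 H2] sub]]]].
split=> [|i x /sub[j [ltj -> _]] jx|i y /sub[j [ltj _ ->]] jy].
- exact: code_sub H0.
- have [y Hy] := H1 j x ltj jx; exists y, m.+1, (x .: e), (y .: e'); split=> // -[|p] ltp.
    by exists 0.
  by have [q [? ? ?]] := sub p ltp; exists q.+1.
have [x Hx] := H2 j y ltj jy; exists x, m.+1, (x .: e), (y .: e'); split=> // -[|p] ltp.
  by exists 0.
by have [q [? ? ?]] := sub p ltp; exists q.+1.
Qed.

Definition apart (X : bstruct) n (e : nat -> X) m (f : nat -> X) : Prop :=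
  forall i j, i < n -> j < m -> ~ conn (e i) (f j).

Definition covered (X Y : bstruct) n (e : nat -> X) (e' : nat -> Y)
    n1 (e1 : nat -> X) (e1' : nat -> Y) n2 (e2 : nat -> X) (e2' : nat -> Y) : Prop :=
  forall i, i < n -> (exists j, [/\ j < n1, e i = e1 j & e' i = e1' j]) \/
                     (exists j, [/\ j < n2, e i = e2 j & e' i = e2' j]).

(** Two locally equivalent pieces in disjoint sets of components. Nothing relates the pieces, and a
    local move extends just one of them without leaving its components, so these pairs again form a
    local system. *)
Definition joined (X Y : bstruct) n (e : nat -> X) (e' : nat -> Y) : Prop :=
  exists n1 e1 e1' n2 e2 e2', [/\ lpi n1 e1 e1', lpi n2 e2 e2',
    apart n1 e1 n2 e2, apart n1 e1' n2 e2' & @covered X Y n e e' n1 e1 e1' n2 e2 e2'].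

Lemma joined_sym (X Y : bstruct) n (e : nat -> X) (e' : nat -> Y) :
  joined n e e' -> joined n e' e.
Proof.
move=> [n1 [e1 [e1' [n2 [e2 [e2' [/lpi_sym L1 /lpi_sym L2 S S' C]]]]]]].
exists n1, e1', e1, n2, e2', e2; split=> // i /C[][j [? ? ?]]; [left | right]; by exists j.
Qed.

Lemma apart_sym (X : bstruct) n (e : nat -> X) m (f : nat -> X) :
  apart n e m f -> apart m f n e.
Proof. by move=> S i j lti ltj /conn_sym; apply: S. Qed.

Lemma joined_forth (X Y : bstruct) n (e : nat -> X) (e' : nat -> Y)
    n1 (e1 : nat -> X) (e1' : nat -> Y) n2 (e2 : nat -> X) (e2' : nat -> Y) i x :
  lpi n1 e1 e1' -> lpi n2 e2 e2' -> apart n1 e1 n2 e2 -> apart n1 e1' n2 e2' ->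
  covered n e e' n1 e1 e1' n2 e2 e2' ->
  i < n1 -> edge (e1 i) x -> exists y, joined n.+1 (x .: e) (y .: e').
Proof.
move=> L1 L2 S S' C lti ix; have [_ /(_ i x lti ix)[y Hy] _] := lpi_lpisys L1.
have [C0 _ _] := lpi_lpisys Hy.
have iy : edge (e1' i) y by apply: (@code0_edge _ _ _ _ _ i.+1 0 C0).
exists y, n1.+1, (x .: e1), (y .: e1'), n2, e2, e2'; split=> //.
- move=> [|l] j ltl ltj /=; last exact: S.
  by move=> xj; apply: (S i j) => //; apply: conn_trans (conn_edge (conn_refl _) ix) xj.
- move=> [|l] j ltl ltj /=; last exact: S'.
  by move=> yj; apply: (S' i j) => //; apply: conn_trans (conn_edge (conn_refl _) iy) yj.
move=> [|l] ltl /=; first by left; exists 0.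
have [[j [? ? ?]]|H] := C l ltl; last by right.
by left; exists j.+1.
Qed.

Lemma joined_step (X Y : bstruct) n (e : nat -> X) (e' : nat -> Y) i x :
  joined n e e' -> i < n -> edge (e i) x -> exists y, joined n.+1 (x .: e) (y .: e').
Proof.
move=> [n1 [e1 [e1' [n2 [e2 [e2' [L1 L2 S S' C]]]]]]] /C[][j [ltj -> _]] jx.
  exact: joined_forth L1 L2 S S' C ltj jx.
apply: joined_forth L2 L1 (apart_sym S) (apart_sym S') _ ltj jx.
by move=> l /C[]; [right | left].
Qed.

Lemma code0_joined (X Y : bstruct) n (e : nat -> X) (e' : nat -> Y) :
  joined n e e' -> code 0 n e = code 0 n e'.
Proof.
move=> [n1 [e1 [e1' [n2 [e2 [e2' [L1 L2 S S' C]]]]]]].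
have [/code0P C1 _ _] := lpi_lpisys L1; have [/code0P C2 _ _] := lpi_lpisys L2.
have far (Z : bstruct) (z t : Z) : ~ conn z t -> z <> t /\ ~ edge z t.
  move=> N; split=> [E|/(conn_edge (conn_refl _))//].
  by apply: N; rewrite E; apply: conn_refl.
have far2 (z t : X) (z' t' : Y) : ~ conn z t -> ~ conn z' t' ->
    (z = t <-> z' = t') /\ (rel_of z t <-> rel_of z' t').
  by move=> /far[? N] /far[? N']; split; split=> // H; [case: N | case: N']; left.
apply/code0P => i j /C[][i' [lti -> ->]] /C[][j' [ltj -> ->]].
- exact: C1.
- by apply: far2; [apply: S | apply: S'].
- by apply: far2 => /conn_sym; [apply: S | apply: S'].
- exact: C2.
Qed.

Lemma lpi_join (X Y : bstruct) n (e : nat -> X) (e' : nat -> Y) :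
  joined n e e' -> lpi n e e'.
Proof.
move=> H; exists (@joined X Y); split=> // {H}m f f' H.
split=> [|i x ltin ix|i y ltin iy]; first exact: code0_joined.
  exact: joined_step ix.
by have [x /joined_sym Hx] := joined_step (joined_sym H) ltin iy; exists x.
Qed.

Lemma pi_lpi (X Y : bstruct) n (e : nat -> X) (e' : nat -> Y) : pi n e e' -> lpi n e e'.
Proof.
move=> H; exists (@pi X Y); split=> // {H}m f f' /pi_bfsys[H0 H1 H2].
by split=> // [i x _ _|i y _ _].
Qed.

Lemma lpi_conn (X Y : bstruct) n (e : nat -> X) (e' : nat -> Y) i x :
  lpi n e e' -> i < n -> conn (e i) x ->
  exists y, conn (e' i) y /\ lpi n.+1 (x .: e) (y .: e').
Proof.
move=> H ltin [d]; elim: d x => [|d IHd] x /=.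
  move=> <-; exists (e' i); split; first exact: conn_refl.
  by apply: lpi_sub H => -[|j] ltj; [exists i | exists j].
move=> [u [/IHd[v [iv Hv]] ux]].
have [_ /(_ 0 x isT ux)[y Hy] _] := lpi_lpisys Hv.
have [C _ _] := lpi_lpisys Hy.
exists y; split; last by apply: lpi_sub Hy => -[|j] ltj; [exists 0 | exists j.+2].
apply: conn_edge iv _; exact: (@code0_edge _ _ _ _ _ 1 0 C).
Qed.

Lemma lpi_connE (X Y : bstruct) n (e : nat -> X) (e' : nat -> Y) i j :
  lpi n e e' -> i < n -> j < n -> conn (e i) (e j) <-> conn (e' i) (e' j).
Proof.
suff H (V Z : bstruct) (f : nat -> V) (f' : nat -> Z) : lpi n f f' -> i < n -> j < n ->
    conn (f i) (f j) -> conn (f' i) (f' j).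
  by move=> L lti ltj; split; apply: H => //; apply: lpi_sym.
move=> L lti ltj /(lpi_conn L lti)[y [iy /lpi_lpisys[/code0P C _ _]]].
by have [[/(_ erefl) /= <- _] _] := C 0 j.+1 isT ltj.
Qed.

(** Adjacency, unlike connectedness, is decided coordinatewise: a neighbour in the ultrapower is a
    neighbour at almost all coordinates, and the answers are chosen there. *)
Lemma lpi_upow (X Y : bstruct) n (f : nat -> nat -> X) (f' : nat -> nat -> Y) :
  ultra (fun i => lpi n (fun j => f j i) (fun j => f' j i)) ->
  lpi n (fun j => cls (f j) : upow X) (fun j => cls (f' j) : upow Y).
Proof.
move=> H; exists (fun n (e : nat -> upow X) (e' : nat -> upow Y) =>
  exists (f : nat -> nat -> X) (f' : nat -> nat -> Y),
  [/\ e = (fun j => cls (f j)), e' = (fun j => cls (f' j)) &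
     ultra (fun i => lpi n (fun j => f j i) (fun j => f' j i))]).
split=> [m e e'|]; last by exists f, f'.
move=> {n f f' H}[f [f' [-> -> H]]]; rename m into n.
have scE (Z : bstruct) (z : nat -> Z) (g : nat -> nat -> Z) i :
    (fun j => (z .: g) j i) = (z i .: fun j => g j i) by apply/funext => -[].
have scC (Z : bstruct) (z : upow Z) (g : nat -> nat -> Z) :
    (z .: fun j => cls (g j)) = (fun j => cls ((rep z .: g) j)).
  by apply/funext => -[] //=; rewrite repK.
split=> [|i x ltin ix|i y ltin iy].
- have [t Ht] := ultra_lim (fun i => code 0 n (fun j => f j i)).
  rewrite (proj2 (los _ _) Ht); symmetry; apply/los.
  by apply: (ultra_mono (ultra_and H Ht)) => i [/lpi_lpisys[<-]].
- have {}ix : ultra (fun l => edge (f i l) (rep x l)).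
    by move: ix; rewrite -[x]repK; case=> /cls_rel => h;
      apply: (ultra_mono (ultra_and h (rep_cls (rep x)))) => l [? ->]; [left|right].
  have /choice[y Hy] l : exists y : Y, lpi n (fun j => f j l) (fun j => f' j l) ->
      edge (f i l) (rep x l) -> lpi n.+1 (rep x l .: fun j => f j l) (y .: fun j => f' j l).
    have [[/lpi_lpisys[_ F _] E]|N] := pselect (lpi n (fun j => f j l) (fun j => f' j l) /\
       edge (f i l) (rep x l)).
      by have [y Hy] := F i _ ltin E; exists y.
    by exists (pt Y) => ? ?; case: N.
  exists (cls y), (rep x .: f), (y .: f'); split; first exact: scC.
    by apply/funext => -[].
  by apply: (ultra_mono (ultra_and H ix)) => l [? ?]; rewrite !scE; apply: Hy.
have {}iy : ultra (fun l => edge (f' i l) (rep y l)).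
  by move: iy; rewrite -[y]repK; case=> /cls_rel => h;
      apply: (ultra_mono (ultra_and h (rep_cls (rep y)))) => l [? ->]; [left|right].
have /choice[x Hx] l : exists x : X, lpi n (fun j => f j l) (fun j => f' j l) ->
    edge (f' i l) (rep y l) -> lpi n.+1 (x .: fun j => f j l) (rep y l .: fun j => f' j l).
  have [[/lpi_lpisys[_ _ F] E]|N] := pselect (lpi n (fun j => f j l) (fun j => f' j l) /\
     edge (f' i l) (rep y l)).
    by have [x Hx] := F i _ ltin E; exists x.
  by exists (pt X) => ? ?; case: N.
exists (cls x), (x .: f), (rep y .: f'); split; last 1 first.
- by apply: (ultra_mono (ultra_and H iy)) => l [? ?]; rewrite !scE; apply: Hx.
- by apply/funext => -[].
- exact: scC.
Qed.

(* The pointed components of [x] and [y] are potentially isomorphic. *)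
Definition alike (X Y : bstruct) (x : X) (y : Y) : Prop :=
  lpi 1 (fun=> x) (fun=> y).

Lemma alike_refl (X : bstruct) (x : X) : alike x x.
Proof. exact: lpi_refl. Qed.

Lemma alike_sym (X Y : bstruct) (x : X) (y : Y) : alike x y -> alike y x.
Proof. exact: lpi_sym. Qed.

Lemma alike_trans (X Y Z : bstruct) (x : X) (y : Y) (z : Z) :
  alike x y -> alike y z -> alike x z.
Proof. exact: lpi_trans. Qed.

Lemma lpi_alike (X Y : bstruct) n (e : nat -> X) (e' : nat -> Y) i :
  lpi n e e' -> i < n -> alike (e i) (e' i).
Proof. by move=> H lti; apply: lpi_sub H => j _; exists i. Qed.

Lemma alike_conn (X Y : bstruct) (x x' : X) (y : Y) :
  alike x y -> conn x x' -> exists y', conn y y' /\ alike x' y'.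
Proof.
move=> H xx'; have [y' [yy' Hy']] := lpi_conn H (ltnSn 0) xx'.
by exists y'; split=> //; apply: (lpi_alike (i := 0) Hy').
Qed.

(* At least [k] components of [Y] meeting [P] are potentially isomorphic to that
   of [z]. *)
Definition multP (Y : bstruct) (P : Y -> Prop) (Z : bstruct) (z : Z) k : Prop :=
  exists w : nat -> Y, (forall i j, i < k -> j < k -> i <> j -> ~ conn (w i) (w j)) /\
    (forall i, i < k -> alike (w i) z /\ P (w i)).

Definition mult (Y Z : bstruct) (z : Z) k : Prop := multP (fun _ : Y => True) z k.
Arguments mult Y {Z} z k.

Lemma multP_le (Y : bstruct) (P : Y -> Prop) (Z : bstruct) (z : Z) j k :
  j <= k -> multP P z k -> multP P z j.
Proof.
by move=> jk [w [H1 H2]]; exists w; split=> [a b lta ltb|a lta]; [apply: H1 | apply: H2];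
  apply: leq_trans jk.
Qed.

Lemma multP0 (Y : bstruct) (P : Y -> Prop) (Z : bstruct) (z : Z) : multP P z 0.
Proof. by exists (fun=> pt Y). Qed.

Lemma multP_alike (Y : bstruct) (P : Y -> Prop) (Z Z' : bstruct) (z : Z) (z' : Z') k :
  alike z z' -> multP P z k -> multP P z' k.
Proof.
move=> zz' [w [H1 H2]]; exists w; split=> // i /H2[? ?]; split=> //.
exact: alike_trans zz'.
Qed.

Lemma mult_conn (Y Z : bstruct) (z z' : Z) k : conn z z' -> mult Y z k -> mult Y z' k.
Proof.
move=> zz' [w [H1 H2]].
have /choice[v Hv] i : exists v : Y, i < k -> conn (w i) v /\ alike v z'.
  have [ltik|_] := ltnP i k; last by exists (pt Y).
  have [v [? ?]] := alike_conn (alike_sym (proj1 (H2 i ltik))) zz'.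
  by exists v => _; split=> //; apply: alike_sym.
exists v; split=> [i j lti ltj ij vv|i /Hv[]//].
apply: (H1 i j) => //; apply: conn_trans (proj1 (Hv i lti)) _.
by apply: conn_trans vv _; apply: conn_sym; case: (Hv j ltj).
Qed.

Lemma multP_split (Y : bstruct) (P : Y -> Prop) (Z : bstruct) (z : Z) k :
  mult Y z k -> exists i j, [/\ i + j = k, multP P z i & multP (fun y => ~ P y) z j].
Proof.
elim: k => [|k IHk]; first by exists 0, 0; split=> //; apply: multP0.
move=> [w [H1 H2]].
(* The witnesses are sorted by [P] and kept among the values of [w], so the next [w m] is connected
   to none of those already sorted. *)
suff [i [j [E [u [[U1 U2] U3]] [v [[V1 V2] V3]]]]] : exists i j, [/\ i + j = k.+1,
    exists u, ((forall a b, a < i -> b < i -> a <> b -> ~ conn (u a) (u b)) /\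
       forall a, a < i -> alike (u a) z /\ P (u a)) /\
       (forall a, a < i -> exists b, b < k.+1 /\ u a = w b)
  & exists v, ((forall a b, a < j -> b < j -> a <> b -> ~ conn (v a) (v b)) /\
       forall a, a < j -> alike (v a) z /\ ~ P (v a)) /\
       (forall a, a < j -> exists b, b < k.+1 /\ v a = w b)].
  by exists i, j; split=> //; [exists u | exists v].
elim: {IHk} k.+1 H1 H2 => [|m IHm] H1 H2.
  by exists 0, 0; split=> //; exists (fun=> pt Y).
have [||i [j [E [u [[U1 U2] U3]] [v [[V1 V2] V3]]]]] := IHm.
- by move=> a b lta ltb; apply: H1; apply: ltnW.
- by move=> a lta; apply: H2; apply: ltnW.
have wu n (t : nat -> Y) : (forall a, a < n -> exists b, b < m /\ t a = w b) ->
    forall a, a < n -> ~ conn (w m) (t a) /\ ~ conn (t a) (w m).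
  move=> T a /T[b [ltb ->]]; split; apply: H1; lia.
have up n (t : nat -> Y) : (forall a, a < n -> exists b, b < m /\ t a = w b) ->
    forall a, a < n -> exists b, b < m.+1 /\ t a = w b.
  by move=> T a /T[b [ltb ->]]; exists b; split=> //; lia.
have [Pw|nPw] := pselect (P (w m)); [exists i.+1, j | exists i, j.+1].
  split; first lia; last by exists v; split=> //; apply: up.
  exists (w m .: u); split; last first.
    by move=> [|a] lta; [exists m | apply: (up _ _ U3)].
  split=> [[|a] [|b] lta ltb ab //=|[|a] lta //=]; last by apply: U2.
  - by case: (wu _ _ U3 b).
  - by case: (wu _ _ U3 a).
  - by apply: U1 => //; congruence.
  - by case: (H2 m).
split; first lia; first by exists u; split=> //; apply: up.
exists (w m .: v); split; last first.
  by move=> [|a] lta; [exists m | apply: (up _ _ V3)].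
split=> [[|a] [|b] lta ltb ab //=|[|a] lta //=]; last by apply: V2.
- by case: (wu _ _ V3 b).
- by case: (wu _ _ V3 a).
- by apply: V1 => //; congruence.
- by case: (H2 m).
Qed.

Lemma multP_join (Y : bstruct) (P : Y -> Prop) (Z : bstruct) (z : Z) i j :
  (forall x y, conn x y -> P x -> P y) ->
  multP P z i -> multP (fun y => ~ P y) z j -> mult Y z (i + j).
Proof.
move=> Pconn [u [U1 U2]] [v [V1 V2]].
exists (fun a => if a < i then u a else v (a - i)).
have sep a b : a < i -> b < j -> ~ conn (u a) (v b).
  by move=> /U2[_ Pu] /V2[_ nPv] uv; apply: nPv; apply: Pconn uv Pu.
split=> [a b lta ltb ab|a lta].
  case: ltnP => ai; case: ltnP => bi.
  - exact: U1.
  - by apply: sep => //; lia.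
  - by move=> /conn_sym; apply: sep => //; lia.
  - by apply: V1; lia.
by case: ltnP => ai; split=> //; [case: (U2 a) | case: (V2 (a - i)) => //; lia].
Qed.

Lemma lpi_far (X Y : bstruct) n (e : nat -> X) (e' : nat -> Y) x y :
  lpi n e e' -> (forall i, i < n -> ~ conn (e i) x) -> (forall i, i < n -> ~ conn (e' i) y) ->
  alike x y -> lpi n.+1 (x .: e) (y .: e').
Proof.
move=> L Nx Ny xy; apply: lpi_join; exists n, e, e', 1, (fun=> x), (fun=> y); split=> //.
- by move=> i j lti _; apply: Nx.
- by move=> i j lti _; apply: Ny.
- by move=> [|i] lti; [right; exists 0 | left; exists i].
Qed.

(** Pigeonhole: one point meets at most one of the [k] components. *)
Lemma untouched (Y : bstruct) (w : nat -> Y) k n (I : {set 'I_n}) (e : nat -> Y) :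
  (forall i j, i < k -> j < k -> i <> j -> ~ conn (w i) (w j)) -> #|I| < k ->
  exists2 l, l < k & forall i : 'I_n, i \in I -> ~ conn (e i) (w l).
Proof.
move=> W ltIk; apply: contrapT => N.
have /choice[r Hr] (l : 'I_k) : exists i : 'I_n, i \in I /\ conn (e i) (w l).
  apply: contrapT => Nl; apply: N; exists l => // i iI il; apply: Nl; by exists i.
have rinj : injective r.
  move=> l l' E; apply/val_inj; apply: contrapT => ll'.
  apply: (W l l') => //; apply: conn_trans (conn_sym (proj2 (Hr l))) _.
  by rewrite E; case: (Hr l').
have : #|codom r| <= #|I|.
  by apply: subset_leq_card; apply/fintype.subsetP => i /codomP[l ->]; case: (Hr l).
by rewrite card_codom // card_ord leqNgt ltIk.
Qed.

(* The components met by [e] and potentially isomorphic to that of [x] are as many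
   as those met by [e'], and the component of [x] is one more. *)
Lemma fresh (X Y : bstruct) n (e : nat -> X) (e' : nat -> Y) x :
  lpi n e e' -> (forall i, i < n -> ~ conn (e i) x) ->
  (forall k, mult X x k -> mult Y x k) ->
  exists y, (forall i, i < n -> ~ conn (e' i) y) /\ alike x y.
Proof.
move=> L Nx M.
pose lk i := exists u, conn (e i) u /\ alike u x.
(* [I] keeps the first index in each component met by [e] that is potentially isomorphic to that of
   [x], so [#|I|] counts these components. *)
pose I : {set 'I_n} := finset (fun i : 'I_n => `[< lk i >] &&
  [forall j : 'I_n, (j < i) ==> ~~ `[< conn (e j) (e i) >]]).
have IP (i : 'I_n) : i \in I <-> lk i /\ forall j : 'I_n, j < i -> ~ conn (e j) (e i).
  rewrite inE; split=> [/andP[/asboolP ? /forallP h]|[? h]].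
    by split=> // j ltj; apply/asboolPn; apply: (implyP (h j)).
  apply/andP; split; first exact/asboolP.
  by apply/forallP => j; apply/implyP => ltj; apply/asboolPn; apply: h.
have Isep (i j : 'I_n) : i \in I -> j \in I -> i <> j -> ~ conn (e i) (e j).
  move=> /IP[_ hi] /IP[_ hj] ij; have [ltij|ltji|/val_inj//] := ltngtP i j.
    exact: hj.
  by move=> /conn_sym; apply: hi.
have /choice[u Hu] i : exists u, lk i -> conn (e i) u /\ alike u x.
  have [[u Hu]|?] := pselect (lk i); first by exists u.
  by exists (pt X).
have {}Hu i : i \in I -> conn (e i) (u i) /\ alike (u i) x by move=> /IP[/Hu].
have Mx : mult X x #|I|.+1.
  pose v l := if l is l'.+1
    then (if insub l' is Some p then u (@enum_val _ (mem I) p) else x) else x.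
  have vS l (ltl : l < #|I|) : v l.+1 = u (@enum_val _ (mem I) (Ordinal ltl)) by rewrite /v insubT.
  have xu i : i \in I -> ~ conn x (u i).
    move=> iI h; apply: (Nx i) => //.
    exact: conn_trans (proj1 (Hu _ iI)) (conn_sym h).
  exists v; split=> [[|a] [|b] lta ltb ab //|[|a] lta].
  - by rewrite (vS _ ltb); apply: xu; apply: enum_valP.
  - by rewrite (vS _ lta) => /conn_sym; apply: xu; apply: enum_valP.
  - rewrite (vS _ lta) (vS _ ltb) => h.
    set i := enum_val _ in h; set j := enum_val _ in h.
    have iI : i \in I by apply: enum_valP.
    have jI : j \in I by apply: enum_valP.
    apply: (Isep i j) => //; first by move=> /enum_val_inj[E]; apply: ab; rewrite E.
    apply: conn_trans (proj1 (Hu _ iI)) _.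
    by apply: conn_trans h _; apply: conn_sym; case: (Hu _ jI).
  - by split=> //; apply: alike_refl.
  - by rewrite (vS _ lta); split=> //; case: (Hu _ (enum_valP (Ordinal (lta : a < #|I|)))).
have [w [W1 W2]] := M _ Mx.
have [l ltl Hl] := untouched e' W1 (ltnSn _).
have [wx _] := W2 l ltl.
exists (w l); split; last exact: alike_sym.
move=> i0 lti0 h0.
(* The least index of an entry of [e'] meeting the component of [w l] belongs to [I] by local
   equivalence, against the choice of [l]. *)
have [i [lti hi imin]] : exists i, [/\ i < n, conn (e' i) (w l) &
    forall j, j < i -> ~ (j < n /\ conn (e' j) (w l))].
  have ex : exists i, `[< i < n /\ conn (e' i) (w l) >] by exists i0; apply/asboolP.
  exists (ex_minn ex); case: ex_minnP => i /asboolP[? ?] imin; split=> // j ltj hj.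
  by have := imin j (introT (asboolP _) hj); rewrite leqNgt ltj.
apply: (Hl (Ordinal lti)) => //; apply/IP; split.
  have [v [? hv]] := alike_conn (alike_sym (lpi_alike L lti)) hi.
  by exists v; split=> //; apply: alike_trans (alike_sym hv) wx.
move=> j ltji hji; apply: (imin j) => //; split=> //.
by apply: conn_trans hi; apply/(lpi_connE L).
Qed.

Lemma lpi_forth (X Y : bstruct) n (e : nat -> X) (e' : nat -> Y) x :
  lpi n e e' -> (forall k, mult X x k -> mult Y x k) ->
  exists y, lpi n.+1 (x .: e) (y .: e').
Proof.
move=> L M; have [[i [lti ix]]|N] := pselect (exists i, i < n /\ conn (e i) x).
  by have [y [_ Hy]] := lpi_conn L lti ix; exists y.
have {}N i : i < n -> ~ conn (e i) x by move=> ? ?; apply: N; exists i.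
have [y [Ny xy]] := fresh L N M; exists y; exact: lpi_far.
Qed.

(** A move to an unmet component is answered in an unmet copy of it, which equal multiplicities
    provide; the other moves are local. *)
Lemma lpi_pi (X Y : bstruct) n (e : nat -> X) (e' : nat -> Y) :
  (forall (x : X) k, mult X x k -> mult Y x k) ->
  (forall (y : Y) k, mult Y y k -> mult X y k) ->
  lpi n e e' -> pi n e e'.
Proof.
move=> M M' L; exists (@lpi X Y); split=> // {L}m f f' L; split=> [|x|y].
- by case: (lpi_lpisys L).
- exact: lpi_forth L (M x).
by have [x /lpi_sym Hx] := lpi_forth (lpi_sym L) (M' y); exists x.
Qed.

Lemma lpi0 (X Y : bstruct) (e : nat -> X) (e' : nat -> Y) : lpi 0 e e'.
Proof.
exists (fun n _ _ => n = 0); split=> // m f f' ->; split=> //.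
by apply/code0P.
Qed.

Lemma pi_sub (X Y : bstruct) m n (e : nat -> X) (e' : nat -> Y) f f' :
  (forall i, i < n -> exists j, [/\ j < m, f i = e j & f' i = e' j]) ->
  pi m e e' -> pi n f f'.
Proof.
move=> sub H; exists (fun n (f : nat -> X) (f' : nat -> Y) =>
  exists m (e : nat -> X) (e' : nat -> Y), pi m e e' /\
  forall i, i < n -> exists j, [/\ j < m, f i = e j & f' i = e' j]).
split=> [l g g'|]; last by exists m, e, e'.
move=> {m n e e' f f' H sub}[m [e [e' [/pi_bfsys[H0 H1 H2] sub]]]].
have step x y i : i < l.+1 -> exists j,
    [/\ j < m.+1, (x .: g) i = (x .: e) j & (y .: g') i = (y .: e') j].
  by case: i => [|i] lti; [exists 0 | have [j [? ? ?]] := sub i lti; exists j.+1].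
split=> [|x|y]; first exact: code_sub H0.
  have [y Hy] := H1 x; exists y, m.+1, (x .: e), (y .: e'); split=> // i; exact: step.
have [x Hx] := H2 y; exists x, m.+1, (x .: e), (y .: e'); split=> // i; exact: step.
Qed.

Lemma pi_ex (X Y : bstruct) n (c : nat -> X) (e : nat -> X) (e' : nat -> Y) :
  pi 0 e e' -> exists d : nat -> Y, pi n c d.
Proof.
move=> H; elim: n => [|n [d Hd]]; first by exists e'; apply: pi_sub H.
have [_ /(_ (c n))[y Hy] _] := pi_bfsys Hd.
exists (fun i => if i < n then d i else y); apply: pi_sub Hy => i lti.
have [ltin|lein] := ltnP i n; first by exists i.+1.
by exists 0; split=> //=; congr c; lia.
Qed.

Lemma mult_pi (X Y Z : bstruct) (e : nat -> X) (e' : nat -> Y) (z : Z) k :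
  pi 0 e e' -> mult X z k -> mult Y z k.
Proof.
move=> H [w [H1 H2]]; have [v Hv] := pi_ex k w H.
exists v; split=> [i j lti ltj ij h|i lti]; last first.
  split=> //; case: (H2 i lti) => + _; apply: alike_trans; apply: alike_sym.
  exact: (lpi_alike (pi_lpi Hv)).
by apply: (H1 i j) => //; apply: tpeq_conn (tpeq_sym (pi_tpeq Hv)) lti ltj h.
Qed.

(* A local back-and-forth system between elementarily equivalent structures
   extends to a global one between their ultrapowers, since saturation makes
   all components occur there equally often. *)
Lemma lpi_tpeq (X Y : bstruct) n (e : nat -> X) (e' : nat -> Y) :
  elemeq X Y -> lpi n e e' -> tpeq n e e'.
Proof.
move=> XY L; have XYu : elemeq (upow X) (upow Y).
  exact: elemeq_trans (elemeq_trans (elemeq_upow X) XY) (elemeq_sym (elemeq_upow Y)).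
have P := pi_upow XYu; have P' := pi_upow (elemeq_sym XYu).
move=> k; rewrite -(los_const n e k) -(los_const n e' k); move: k.
apply: pi_tpeq; apply: lpi_pi => [x k|y k|].
- exact: mult_pi P.
- exact: mult_pi P'.
by apply: lpi_upow; apply: ultra_all.
Qed.

(** * Countable structures, and embeddings onto unions of components *)

Lemma countable_enum (X : bstruct) : countable [set: X] ->
  exists g : nat -> X, forall x, exists i, g i = x.
Proof.
move=> /countable_injP[f finj].
have /choice[g Hg] i : exists x : X, forall y, f y = i -> x = y.
  have [[x fx]|N] := pselect (exists x, f x = i).
    by exists x => y fy; apply: finj; rewrite ?inE //= fx.
  by exists (pt X) => y fy; case: N; exists y.
by exists g => x; exists (f x); apply: Hg.
Qed.

(** Stage [i] adds the [i]-th elements of both enumerations; the isomorphism is the union of the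
    finite graphs [R (s i)]. *)
Lemma pi_iso (X Y : bstruct) (e : nat -> X) (e' : nat -> Y) :
  countable [set: X] -> countable [set: Y] -> pi 0 e e' -> iso X Y.
Proof.
move=> /countable_enum[g Hg] /countable_enum[h Hh] H.
pose T := {n : nat & {p : (nat -> X) * (nat -> Y) | pi n p.1 p.2}}.
pose R (s : T) x y := exists2 j, j < projT1 s &
  (proj1_sig (projT2 s)).1 j = x /\ (proj1_sig (projT2 s)).2 j = y.
have step (i : nat) (s : T) : exists s' : T, [/\ forall x y, R s x y -> R s' x y,
    exists y, R s' (g i) y & exists x, R s' x (h i)].
  case: s => n [[f f'] /= P].
  have [_ /(_ (g i))[y Hy] _] := pi_bfsys P.
  have [_ _ /(_ (h i))[x Hx]] := pi_bfsys Hy.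
  exists (existT _ n.+2 (exist _ (x .: g i .: f, h i .: y .: f') Hx)); split.
  - by move=> a b [j ltj /= [<- <-]]; exists j.+2.
  - by exists y, 1.
  - by exists x, 0.
pose s0 : T := existT _ 0 (exist _ (e, e') H).
pose s := fix s i := if i is j.+1 then projT1 (cid (step j (s j))) else s0.
have sS i : [/\ forall x y, R (s i) x y -> R (s i.+1) x y,
    exists y, R (s i.+1) (g i) y & exists x, R (s i.+1) x (h i)].
  by rewrite /s -/s; case: cid.
have mono i j x y : i <= j -> R (s i) x y -> R (s j) x y.
  move/subnK <-; elim: (j - i) => // d IH /IH; rewrite addSn.
  by case: (sS (d + i)) => + _ _; apply.
have common i j x y x' y' : R (s i) x y -> R (s j) x' y' ->
    (x = x' <-> y = y') /\ (rel_of x x' <-> rel_of y y').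
  move=> /(mono _ _ _ _ (leq_maxl i j))[a lta [<- <-]].
  move=> /(mono _ _ _ _ (leq_maxr i j))[b ltb [<- <-]].
  exact: (tpeqP (pi_tpeq (proj2_sig (projT2 (s (maxn i j)))))).
have /choice[F HF] x : exists y, exists i, R (s i) x y.
  by have [i <-] := Hg x; have [_ [y ?] _] := sS i; exists y, i.+1.
have /choice[G HG] y : exists x, exists i, R (s i) x y.
  by have [i <-] := Hh y; have [_ _ [x ?]] := sS i; exists x, i.+1.
exists F; split; last first.
  by move=> a b; have [i Ha] := HF a; have [j Hb] := HF b; case: (common _ _ _ _ _ _ Ha Hb).
exists G => [x|y].
  have [i Ha] := HF x; have [j Hb] := HG (F x).
  by apply: (proj2 (proj1 (common _ _ _ _ _ _ Hb Ha))).
have [i Ha] := HG y; have [j Hb] := HF (G y).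
by apply: (proj1 (proj1 (common _ _ _ _ _ _ Hb Ha))).
Qed.

(** By the last condition no edge leaves the image, which is thus a union of components; such maps
    are invisible to local systems. *)
Definition cemb (X Y : bstruct) (h : X -> Y) : Prop :=
  [/\ injective h, forall x y, rel_of x y <-> rel_of (h x) (h y) &
      forall x y, edge (h x) y -> exists x', h x' = y].

Lemma cemb_lpi (X Y : bstruct) (h : X -> Y) n (e : nat -> X) :
  cemb h -> lpi n e (h \o e).
Proof.
move=> [hinj hrel hcl]; exists (fun n e e' => e' = h \o e); split=> // {e}m e _ ->.
have sc x : (h x .: h \o e) = h \o (x .: e) by apply/funext => -[].
split=> [|i x _ _|i y lti /hcl[x <-]].
- by apply/code0P => i j _ _ /=; split=> //; split=> [->|/hinj].
- by exists (h x).
- by exists x.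
Qed.

Lemma cemb_alike (X Y : bstruct) (h : X -> Y) x : cemb h -> alike x (h x).
Proof. exact: cemb_lpi (fun=> x). Qed.

Lemma cemb_conn (X Y : bstruct) (h : X -> Y) x y :
  cemb h -> conn (h x) (h y) <-> conn x y.
Proof.
move=> [hinj hrel hcl].
have hedge a b : edge (h a) (h b) <-> edge a b by rewrite /edge !hrel.
split=> -[d]; last first.
  elim: d y => [|d IHd] y /=; first by move->; apply: conn_refl.
  by move=> [z [/IHd ? /hedge ?]]; apply: conn_edge; eauto.
suff H t : connN d (h x) t -> exists y', h y' = t /\ conn x y'.
  by move=> /H[y' [/hinj <-]].
elim: d t => [|d IHd] t /=; first by move=> <-; exists x; split=> //; apply: conn_refl.
move=> [z [/IHd[z' [<- xz]] zt]]; have [t' E] := hcl _ _ zt; rewrite -E in zt *.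
by exists t'; split=> //; apply: conn_edge xz _; apply/hedge.
Qed.

Lemma cemb_mult (X Y : bstruct) (h : X -> Y) (Z : bstruct) (z : Z) k :
  cemb h -> mult X z k <-> multP (fun y => exists x, h x = y) z k.
Proof.
move=> hc; split=> -[w [H1 H2]].
  exists (h \o w); split=> [i j lti ltj ij /=|i lti /=].
    by rewrite cemb_conn //; apply: H1.
  by split; [apply: alike_trans (alike_sym (cemb_alike _ hc)) (proj1 (H2 i lti)) | exists (w i)].
have /choice[v Hv] i : exists x, i < k -> h x = w i.
  have [ltik|_] := ltnP i k; last by exists (pt X).
  by have [_ [x ?]] := H2 i ltik; exists x.
exists v; split=> [i j lti ltj ij|i lti].
  by rewrite -(cemb_conn _ _ hc) !Hv //; apply: H1.
split=> //; apply: alike_trans (cemb_alike _ hc) _.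
by rewrite Hv //; case: (H2 i lti).
Qed.

(** * Omitting types *)

(* Principality relative to the theory of [W]; as [W] is a model, it can be tested
   inside [W]. *)
Definition principal (W : bstruct) n (e : nat -> W) : Prop :=
  exists k, forall e' : nat -> W, code k n e' = code k n e -> tpeq n e' e.

Lemma sub_inhabited (V : bstruct) (P : V -> Prop) v (Pv : P v) : inhabited {x | P x}.
Proof. by split; exists v. Qed.

Definition substr (V : bstruct) (P : V -> Prop) v (Pv : P v) : bstruct :=
  @BStruct {x | P x} (fun x y => rel_of (proj1_sig x) (proj1_sig y)) (sub_inhabited Pv).

Lemma proj1_sig_inj (T : Type) (P : T -> Prop) : injective (@proj1_sig T P).
Proof.
by move=> [x Px] [y Py] /= E; subst y; congr exist; apply: Prop_irrelevance.
Qed.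

Definition range_str (V : bstruct) (s : nat -> V) : bstruct :=
  @substr V (fun x => exists i, s i = x) (s 0) (ex_intro _ 0 erefl).

Lemma range_countable (V : bstruct) (s : nat -> V) : countable [set: range_str s].
Proof.
apply/countable_injP.
have /choice[f Hf] (x : range_str s) : exists i, s i = proj1_sig x by case: x.
by exists f => x y _ _ E; apply: proj1_sig_inj; rewrite -!Hf E.
Qed.

(** The Tarski-Vaught criterion with codes in place of formulas: the terms of [s] form an elementary
    substructure. *)
Lemma tarski_vaught (V : bstruct) (s : nat -> V) :
  (forall k m (sg : nat -> nat) x,
     exists j, code k m.+1 (s j .: s \o sg) = code k m.+1 (x .: s \o sg)) ->
  forall k m (e : nat -> range_str s), code k m e = code k m (@proj1_sig _ _ \o e).
Proof.
move=> TV; elim=> [|k IHk] m e.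
  apply/code0P => i j _ _ /=; split=> //; split=> [->//|]; exact: proj1_sig_inj.
have sc (x : range_str s) : (@proj1_sig _ _ \o (x .: e)) = (proj1_sig x .: (@proj1_sig _ _ \o e)).
  by apply/funext => -[].
apply/codeSP; split=> [x|y].
  by exists (proj1_sig x); rewrite IHk sc.
have /choice[sg Hsg] i : exists j, s j = proj1_sig (e i) by case: (e i).
have Es : s \o sg = @proj1_sig _ _ \o e by apply/funext => i; apply: Hsg.
have [j Hj] := TV k m sg y.
exists (exist _ (s j) (ex_intro _ j erefl)); rewrite IHk sc -Es.
exact: Hj.
Qed.

Section Omit.
Variables (W : bstruct) (nn : nat -> nat) (a : nat -> nat -> W).

(* [(n, k, b)] is the promise that the first [n] terms of the sequence under
   construction have the same type of rank [k] as [b 0, ..., b n.-1]. The sequence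
   itself is then read off the promises in the ultrapower of [W]. *)
Definition stage := (nat * nat * (nat -> W))%type.
Implicit Types (S : stage).

(** The last clause fixes the elements themselves when there is nothing to omit, so that the same
    construction yields a countable model realizing a prescribed type. *)
Definition refines S' S : Prop :=
  [/\ S.1.1 <= S'.1.1, S.1.2 <= S'.1.2, code S.1.2 S.1.1 S'.2 = code S.1.2 S.1.1 S.2 &
      (forall j, principal (nn j) (a j)) -> forall i, i < S.1.1 -> S'.2 i = S.2 i].

Definition ixs (sg : seq nat) : nat -> nat := nth 0 sg.

Definition below (sg : seq nat) n : Prop := forall i, i < size sg -> ixs sg i < n.

(** A Henkin task. With [k < S.1.2], the promise decides whether [t] is realized over the tuple. The
    code [t] is given by a number [r] because its type depends on [k] and [sg]. *)
Definition witnessed k (sg : seq nat) r S : Prop :=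
  [/\ k < S.1.2, below sg S.1.1 & forall t : htype k (size sg).+1, unpickle r = Some t ->
    (exists x, code k (size sg).+1 (x .: S.2 \o ixs sg) = t) ->
    exists j, j < S.1.1 /\ code k (size sg).+1 (S.2 j .: S.2 \o ixs sg) = t].

Definition avoided j (sg : seq nat) S : Prop :=
  below sg S.1.1 /\ (size sg = nn j -> ~ principal (nn j) (a j) ->
    code S.1.2 (nn j) (S.2 \o ixs sg) <> code S.1.2 (nn j) (a j)).

Lemma ex_below sg n : exists N, n <= N /\ below sg N.
Proof.
exists (n + \sum_(x <- sg) x.+1); split; first exact: leq_addr.
move=> i lti; apply: leq_trans (leq_addl _ _).
have : ixs sg i \in sg by apply: mem_nth.
move: (ixs sg i) => y; elim: sg {lti} => // x s IH.
rewrite in_cons big_cons => /orP[/eqP -> |/IH]; lia.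
Qed.

Lemma witness_step S k sg r : exists S', refines S' S /\ witnessed k sg r S'.
Proof.
case: S => [[n l] b]; have [N [nN sgN]] := ex_below sg n.
have [x Hx] : exists x : W, forall t : htype k (size sg).+1, unpickle r = Some t ->
    (exists x, code k (size sg).+1 (x .: b \o ixs sg) = t) ->
    code k (size sg).+1 (x .: b \o ixs sg) = t.
  case E : (unpickle r : option (htype k (size sg).+1)) => [t|]; last by exists (pt W).
  have [[x Hx]|Nx] := pselect (exists x, code k (size sg).+1 (x .: b \o ixs sg) = t).
    by exists x => _ [<-].
  by exists (pt W) => _ [<-] /Nx.
pose b' i := if i < N then b i else x.
have Eb y : code k (size sg).+1 (y .: b' \o ixs sg) = code k (size sg).+1 (y .: b \o ixs sg).
  by apply: code_ext => -[|i] //= lti; rewrite /b' sgN.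
exists (N.+1, maxn l k.+1, b'); split; split=> /=.
- exact: leqW.
- exact: leq_maxl.
- by apply: code_ext => i lti; rewrite /b' (leq_trans lti).
- by move=> _ i lti; rewrite /b' (leq_trans lti).
- exact: leq_maxr.
- by move=> i /sgN; apply: leqW.
move=> t Et [y]; rewrite Eb => Hy; exists N; split=> //.
by rewrite Eb /b' ltnn; apply: Hx => //; exists y.
Qed.

(** If the entries at [sg] have the forbidden type, nonprincipality yields a tuple [c] of another
    type that agrees with them up to rank [l + N]. The [N] surplus ranks pay for moving the first
    [N] entries along, and the promise of rank [l] survives. *)
Lemma avoid_step S j sg : exists S', refines S' S /\ avoided j sg S'.
Proof.
case: S => [[n l] b]; have [N [nN sgN]] := ex_below sg n.
suff [b' [Eb Ep Hb]] : exists b', [/\ code l n b' = code l n b,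
    (forall j, principal (nn j) (a j)) -> forall i, i < n -> b' i = b i &
    size sg = nn j -> ~ principal (nn j) (a j) -> ~ tpeq (nn j) (b' \o ixs sg) (a j)].
  have [K HK] : exists K, size sg = nn j -> ~ principal (nn j) (a j) ->
      code K (nn j) (b' \o ixs sg) <> code K (nn j) (a j).
    have [[E NP]|N'] := pselect (size sg = nn j /\ ~ principal (nn j) (a j)).
      by have /existsNP[K HK] := Hb E NP; exists K.
    by exists 0 => ? ?; case: N'.
  exists (N, maxn l K, b'); split; split=> //=; first exact: leq_maxl.
  by move=> E NP; have := HK E NP; apply: contra_not; apply: code_le (leq_maxr _ _).
have [T|T] := pselect (size sg = nn j /\ ~ principal (nn j) (a j) /\
  tpeq (nn j) (b \o ixs sg) (a j)); last first.
  by exists b; split=> // E NP H; apply: T.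
have [E [NP H]] := T; have {}NP K : exists c : nat -> W,
    code K (nn j) c = code K (nn j) (a j) /\ ~ tpeq (nn j) c (a j).
  by apply: contrapT => N'; apply: NP; exists K => c Hc; apply: contrapT => ?; apply: N'; exists c.
have [c [Hc Nc]] := NP (l + N).
have /(@code_cat _ _ _ _ _ _ _ b)[d Hd] : code (l + N) (nn j) (b \o ixs sg) = code (l + N) (nn j) c.
  by rewrite Hc H.
exists d; split.
- symmetry; apply: code_sub Hd => i lti; exists i.
  by rewrite (leq_trans lti nN) ltn_addr // (leq_trans lti).
- by move=> /(_ j); case: T => _ [].
move=> _ _ Td; apply: Nc; move=> K; rewrite -(Td K); apply: code_ext => i lti.
(* The entry of [b] at [ixs sg i] is repeated at position [N + i], where the other side has [c i];
   rank 0 sees this equality, so [d] has the value [c i] at [ixs sg i]. *)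
move/code0P: (code_le (leq0n _) Hd).
have ltp : ixs sg i < N by apply: sgN; rewrite E.
move=> /(_ (ixs sg i) (N + i)) [||[+ _] _]; [lia|lia|].
rewrite ltp; have -> : (N + i < N) = false by lia.
by rewrite addKn => /(_ erefl) /= ->.
Qed.

Definition task := (nat * seq nat * nat + nat * seq nat)%type.

Definition done (t : task) S : Prop :=
  match t with
  | inl (k, sg, r) => witnessed k sg r S
  | inr (j, sg) => avoided j sg S
  end.

Lemma step S i : exists S', refines S' S /\ forall t : task, unpickle i = Some t -> done t S'.
Proof.
case E : (unpickle i : option task) => [[[[k sg] r]|[j sg]]|].
- by have [S' [? ?]] := witness_step S k sg r; exists S'; split=> // _ [<-].
- by have [S' [? ?]] := avoid_step S j sg; exists S'; split=> // _ [<-].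
by exists S.
Qed.

Lemma omit_chain n (c : nat -> W) : exists S : nat -> stage,
  [/\ S 0 = (n, 0, c), forall i, refines (S i.+1) (S i) &
    forall t : task, exists i, done t (S i)].
Proof.
pose S := fix S i := if i is j.+1 then projT1 (cid (step (S j) j)) else (n, 0, c).
have HS i : refines (S i.+1) (S i) /\ forall t : task, unpickle i = Some t -> done t (S i.+1).
  by rewrite /S -/S; case: cid.
exists S; split=> // [i|t]; first by case: (HS i).
by exists (pickle t).+1; apply: (proj2 (HS _)); rewrite pickleK.
Qed.

Lemma refines_trans S1 S2 S3 : refines S3 S2 -> refines S2 S1 -> refines S3 S1.
Proof.
move=> [n23 k23 c23 p23] [n12 k12 c12 p12]; split; [lia|lia| |].
  rewrite -c12; apply: code_le k12 _.
  by apply: code_sub c23 => i lti; exists i; split=> //; lia.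
by move=> H i lti; rewrite -p12 // p23 //; lia.
Qed.

Lemma refines_le (S : nat -> stage) i j : (forall i, refines (S i.+1) (S i)) ->
  i <= j -> refines (S j) (S i).
Proof.
move=> HS /subnK <-; elim: (j - i) => [|d IH]; first by split.
by rewrite addSn; apply: refines_trans (HS _) IH.
Qed.

Lemma omit n (c : nat -> W) : exists Z : bstruct,
  [/\ countable [set: Z], elemeq Z W,
    forall j, ~ principal (nn j) (a j) -> forall e : nat -> Z, ~ tpeq (nn j) e (a j) &
    (forall j, principal (nn j) (a j)) -> exists e : nat -> Z, tpeq n e c].
Proof.
have [S [S0 HS HT]] := omit_chain n c.
pose s j : upow W := cls (fun l => (S l).2 j).
(* All later stages keep the promise of stage [L], hence so does their limit [s]. *)
have sS L : code (S L).1.2 (S L).1.1 s = code (S L).1.2 (S L).1.1 (S L).2.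
  by apply/los; apply: (ultra_mono (ultra_ge L)) => l /(refines_le HS)[_ _ + _].
have sSP L k m (sg : nat -> nat) : k <= (S L).1.2 -> (forall i, i < m -> sg i < (S L).1.1) ->
    code k m (s \o sg) = code k m ((S L).2 \o sg).
  move=> lek ltsg; apply: code_sub (code_le lek (sS L)) => i lti.
  by exists (sg i); split=> //; apply: ltsg.
have TV k m (sg : nat -> nat) x :
    exists j, code k m.+1 (s j .: s \o sg) = code k m.+1 (x .: s \o sg).
  pose sq := mkseq sg m; pose t := code k (size sq).+1 (x .: s \o sg).
  have [L [ltk bel /(_ t (pickleK t)) W1]] := HT (inl (k, sq, pickle t)).
  have szq : size sq = m by rewrite size_mkseq.
  have pq i : i < m -> ixs sq i = sg i by move=> lti; rewrite /ixs nth_mkseq.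
  have sq_e (V : bstruct) (f : nat -> V) y l p : p <= m ->
      code l p.+1 (y .: f \o ixs sq) = code l p.+1 (y .: f \o sg).
    by move=> lep; apply: code_ext => -[|i] //= lti; rewrite pq //; lia.
  have [|j [ltj Hj]] := W1.
    have : code k.+1 m (s \o ixs sq) = code k.+1 m ((S L).2 \o ixs sq).
      by apply: sSP => // i lti; apply: bel; rewrite szq.
    move=> /codeSP[/(_ x)[y Hy] _]; exists y; rewrite /t szq -Hy.
    exact: sq_e.
  exists j; move: Hj; rewrite /t szq => <-.
  rewrite -sq_e //; apply: code_sub (code_le (ltnW ltk) (sS L)) => -[|i] lti.
    by exists j.
  by exists (ixs sq i); split=> //; apply: bel; rewrite szq.
exists (range_str s); split.
- exact: range_countable.
- apply: elemeq_trans (elemeq_upow W).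
  apply: (@elemeq_of_tpeq _ _ 0 (fun=> pt (range_str s))
    (@proj1_sig _ _ \o (fun=> pt (range_str s)))).
  by move=> k; apply: tarski_vaught.
- move=> j NP e T.
  have /choice[sg Hsg] i : exists l, s l = proj1_sig (e i) by case: (e i).
  pose sq := mkseq sg (nn j); have szq : size sq = nn j by rewrite size_mkseq.
  have [L [bel /(_ szq NP)]] := HT (inr (j, sq)); apply.
  rewrite -(T (S L).1.2) (tarski_vaught TV) -sSP //; last by move=> i lti; apply: bel; rewrite szq.
  by apply: code_ext => i lti; rewrite /= /ixs nth_mkseq.
move=> HP; exists (fun i => exist _ (s i) (ex_intro _ i erefl)) => k.
rewrite (tarski_vaught TV).
rewrite -(los_const n c k); apply: code_ext => i lti /=; congr cls.
apply/funext => l; have [_ _ _ /(_ HP)] := refines_le HS (leq0n l).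
by rewrite S0 /=; apply.
Qed.

End Omit.

(** The case with nothing to omit: the only listed type is that of the empty tuple, which is
    principal. *)
Lemma downward_LS (W : bstruct) n (c : nat -> W) : exists (Z : bstruct) (e : nat -> Z),
  countable [set: Z] /\ tpeq n e c.
Proof.
have [Z [Zc _ _ H]] := @omit W (fun=> 0) (fun _ _ => pt W) n c.
have [|e He] := H; first by move=> _; exists 0 => e' _ k; apply: code_ext.
by exists Z, e.
Qed.

(** A countable structure has countably many finite tuples; [j] encodes one as a list of indices in
    an enumeration. *)
Lemma omit_all (W : bstruct) : countable [set: W] -> exists Z : bstruct,
  [/\ countable [set: Z], elemeq Z W &
    forall n (a : nat -> W), ~ principal n a -> forall e : nat -> Z, ~ tpeq n e a].
Proof.
move=> /countable_enum[g Hg].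
pose dec j : seq nat := odflt [::] (unpickle j).
have [Z [Zc ZW ZO _]] :=
  @omit W (fun j => size (dec j)) (fun j i => g (nth 0 (dec j) i)) 0 (fun=> pt W).
exists Z; split=> // n a NP e He.
have /choice[f Hf] i : exists l, g l = a i by apply: Hg.
pose j := pickle (mkseq f n).
have Ej : dec j = mkseq f n by rewrite /dec pickleK.
have sj : size (dec j) = n by rewrite Ej size_mkseq.
have aj i : i < n -> g (nth 0 (dec j) i) = a i by move=> lti; rewrite Ej nth_mkseq.
have T : tpeq n (fun i => g (nth 0 (dec j) i)) a.
  by move=> k; apply: code_ext.
apply: (ZO j _ e); rewrite sj.
  move=> [k Hk]; apply: NP; exists k => e' He'.
  by apply: (tpeq_trans _ T); apply: Hk; rewrite He' T.
exact: tpeq_trans He (tpeq_sym T).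
Qed.

(** * Sums, products, and structures with finitely many types *)

Lemma iso_refl X : iso X X.
Proof. by exists id; split=> //; exists id. Qed.

Lemma iso_sym X Y : iso X Y -> iso Y X.
Proof.
move=> [f [[g fK gK] fr]]; exists g; split; first by exists f.
by move=> a b; rewrite fr !gK.
Qed.

Lemma iso_trans X Y Z : iso X Y -> iso Y Z -> iso X Z.
Proof.
move=> [f [bf fr]] [g [bg gr]]; exists (g \o f); split; first exact: bij_comp.
by move=> a b; rewrite fr gr.
Qed.

Lemma iso_cemb (X Y : bstruct) (h : X -> Y) : bijective h ->
  (forall a b : X, rel_of a b <-> rel_of (h a) (h b)) -> cemb h.
Proof.
move=> [g hK gK] hr; split=> // [|x y _]; first exact: can_inj hK.
by exists (g y).
Qed.

Lemma iso_elemeq (X Y : bstruct) : iso X Y -> elemeq X Y.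
Proof.
move=> [h [bh hr]]; have [g hK gK] := bh.
suff H : pi 0 (fun=> pt X) (h \o (fun=> pt X)).
  exact: elemeq_of_tpeq (pi_tpeq H).
exists (fun n e e' => e' = h \o e); split=> // n e _ ->.
have sc x : (h x .: h \o e) = h \o (x .: e) by apply/funext => -[].
split=> [|x|y].
- by have [] := lpi_lpisys (cemb_lpi n e (iso_cemb bh hr)).
- by exists (h x).
- by exists (g y); rewrite -sc gK.
Qed.

Lemma existT_inj (I : Type) (X : I -> Type) i (x y : X i) :
  existT X i x = existT X i y -> x = y.
Proof.
move=> E; have := projT2_eq E; rewrite (Prop_irrelevance (projT1_eq E) erefl).
by [].
Qed.

Lemma ext_fam (I : Type) (X : I -> bstruct) i (x : X i) :
  exists g : forall i, X i, g i = x.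
Proof.
exists (fun j => if pselect (i = j) is left E then eq_rect i X x j E else pt (X j)).
by case: pselect => // E; rewrite (Prop_irrelevance E erefl).
Qed.

Lemma dchoice (I : Type) (X : I -> Type) (P : forall i, X i -> Prop) :
  (forall i, exists x, P i x) -> exists g : forall i, X i, forall i, P i (g i).
Proof.
by move=> H; exists (fun i => projT1 (cid (H i))) => i; case: cid.
Qed.

Lemma gsum_inhabited (I : Type) (i0 : I) (X : I -> bstruct) : inhabited {i & X i}.
Proof. by split; exists i0; apply: pt. Qed.

Definition gsum (I : Type) (i0 : I) (X : I -> bstruct) : bstruct :=
  @BStruct {i : I & X i} (fun a b => exists (i : I) (x y : X i),
     [/\ a = existT _ i x, b = existT _ i y & rel_of x y]) (gsum_inhabited i0 X).

Lemma gsum_rel (I : Type) (i0 : I) (X : I -> bstruct) i (x y : X i) :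
  @rel_of (gsum i0 X) (existT _ i x) (existT _ i y) <-> rel_of x y.
Proof.
split=> [[j [x' [y' [E1 E2 R]]]]|R]; last by exists i, x, y.
have E := projT1_eq E1; simpl in E; subst j.
by rewrite (existT_inj E1) (existT_inj E2).
Qed.

Lemma gsum_cemb (I : Type) (i0 : I) (X : I -> bstruct) i :
  @cemb (X i) (gsum i0 X) (existT _ i).
Proof.
split=> [x y|x y|x [j y]]; first exact: existT_inj.
  by rewrite gsum_rel.
by case=> -[l [x' [y' [E1 E2 R]]]]; have E := projT1_eq E1; have E' := projT1_eq E2;
  simpl in E, E'; subst l; subst j; exists y.
Qed.

Lemma gsum_conn (I : Type) (i0 : I) (X : I -> bstruct) (a b : gsum i0 X) :
  conn a b -> projT1 a = projT1 b.
Proof.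
move=> [d]; elim: d b => [|d IHd] b /=; first by move->.
by move=> [z [/IHd ->]] [] [i [x [y [-> -> _]]]].
Qed.

(** A Feferman-Vaught argument at fixed rank. [f i] is the part of the tuple in summand [i], padded
    at the positions lying elsewhere so that all parts have length [n]. A move in one summand is
    accompanied by arbitrary moves in the others. *)
Lemma gsum_code (I : Type) (i0 j0 : I) (X Y : I -> bstruct) k n
    (e : nat -> gsum i0 X) (e' : nat -> gsum j0 Y)
    (f : forall i, nat -> X i) (f' : forall i, nat -> Y i) :
  (forall i, code k n (f i) = code k n (f' i)) ->
  (forall j, j < n -> exists i, e j = existT _ i (f i j) /\ e' j = existT _ i (f' i j)) ->
  code k n e = code k n e'.
Proof.
elim: k n e e' f f' => [|k IHk] n e e' f f' H C.
  suff D (V Z : I -> bstruct) (v0 z0 : I) (a : nat -> gsum v0 V) (b : nat -> gsum z0 Z)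
      (g : forall i, nat -> V i) (g' : forall i, nat -> Z i) :
      (forall i, code 0 n (g i) = code 0 n (g' i)) ->
      (forall j, j < n -> exists i, a j = existT _ i (g i j) /\ b j = existT _ i (g' i j)) ->
      forall j l, j < n -> l < n -> (a j = a l -> b j = b l) /\
        (rel_of (a j) (a l) -> rel_of (b j) (b l)).
    apply/code0P => j l ltj ltl.
    have [D1 D2] := D _ _ _ _ _ _ _ _ H C j l ltj ltl.
    have [||D1' D2'] := D _ _ _ _ e' e f' f _ _ j l ltj ltl; [by []| |by []].
    by move=> p /C[i []]; exists i.
  move=> {}H {}C j l ltj ltl; have [i [-> ->]] := C j ltj; have [p [-> ->]] := C l ltl.
  split=> [E|[q [x [y [E1 E2 R]]]]].
    have ip := projT1_eq E; simpl in ip; subst p; congr existT.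
    by have /code0P/(_ j l ltj ltl)[[+ _] _] := H i; apply; apply: existT_inj E.
  have iq := projT1_eq E1; have pq := projT1_eq E2; simpl in iq, pq; subst i; subst p.
  apply/gsum_rel; move: R; rewrite -(existT_inj E1) -(existT_inj E2).
  by have /code0P/(_ j l ltj ltl)[_ [+ _]] := H q.
apply/codeSP; split=> [[i x]|[i y]].
  have [u Eu] := ext_fam x.
  have /dchoice[v Hv] p : exists y : Y p, code k n.+1 (u p .: f p) = code k n.+1 (y .: f' p).
    by have /codeSP[/(_ (u p))] := H p.
  exists (existT _ i (v i)); apply: IHk Hv _ => -[|j] ltj /=; first by exists i; rewrite Eu.
  exact: C.
have [v Ev] := ext_fam y.
have /dchoice[u Hu] p : exists x : X p, code k n.+1 (x .: f p) = code k n.+1 (v p .: f' p).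
  by have /codeSP[_ /(_ (v p))] := H p.
exists (existT _ i (u i)); apply: IHk Hu _ => -[|j] ltj /=; first by exists i; rewrite Ev.
exact: C.
Qed.

Lemma gsum_elemeq (I : Type) (i0 j0 : I) (X Y : I -> bstruct) :
  (forall i, elemeq (X i) (Y i)) -> elemeq (gsum i0 X) (gsum j0 Y).
Proof.
move=> H k; apply: (gsum_code (f := fun i _ => pt (X i)) (f' := fun i _ => pt (Y i))) => // i.
exact: H.
Qed.

Lemma gprod_inhabited (J : Type) (X : J -> bstruct) : inhabited (forall j, X j).
Proof. by split=> j; apply: pt. Qed.

Definition gprod (J : Type) (X : J -> bstruct) : bstruct :=
  @BStruct (forall j, X j) (fun a b => forall j, rel_of (a j) (b j)) (gprod_inhabited X).

(** A move in the product is a simultaneous move in all factors. *)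
Lemma gprod_code (J : Type) (X Y : J -> bstruct) k n
    (e : nat -> gprod X) (e' : nat -> gprod Y) :
  (forall j, code k n (e^~ j) = code k n (e'^~ j)) -> code k n e = code k n e'.
Proof.
elim: k n e e' => [|k IHk] n e e' H.
  apply/code0P => i l lti ltl.
  have {}H j := proj1 (code0P _ _ _) (H j) i l lti ltl.
  split; last by split=> R j; apply/(proj2 (H j)).
  split=> E; apply: functional_extensionality_dep => j; apply/(proj1 (H j)).
    by rewrite E.
  by rewrite E.
have sc (V : J -> bstruct) (x : gprod V) (f : nat -> gprod V) j :
    (x .: f)^~ j = (x j .: f^~ j) by apply/funext => -[].
apply/codeSP; split=> [x|y].
  have /dchoice[y Hy] j : exists y : Y j, code k n.+1 (x j .: e^~ j) = code k n.+1 (y .: e'^~ j).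
    by have /codeSP[/(_ (x j))] := H j.
  by exists y; apply: IHk => j; rewrite !sc.
have /dchoice[x Hx] j : exists x : X j, code k n.+1 (x .: e^~ j) = code k n.+1 (y j .: e'^~ j).
  by have /codeSP[_ /(_ (y j))] := H j.
by exists x; apply: IHk => j; rewrite !sc.
Qed.

(** * Finitely many types in each arity: the Ryll-Nardzewski theorem *)

Definition fintypes (X : bstruct) : Prop := forall n, exists (F : finType) (cl : (nat -> X) -> F),
  forall e e', cl e = cl e' -> tpeq n e e'.

(** Two classes either have the same type or are separated at some rank; the maximum over the
    finitely many pairs of classes decides all types. *)
Lemma fintypesP (X : bstruct) : fintypes X <->
  forall n, exists k, forall e e' : nat -> X, code k n e = code k n e' -> tpeq n e e'.
Proof.
split=> H n; last by have [k Hk] := H n; exists (htype k n), (fun e => code k n e).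
have [F [cl Hcl]] := H n.
have /choice[K HK] (p : F * F) : exists k, forall e e', cl e = p.1 -> cl e' = p.2 ->
    code k n e = code k n e' -> tpeq n e e'.
  apply: contrapT => N; have N0 k : exists e e', [/\ cl e = p.1, cl e' = p.2 &
      code k n e = code k n e' /\ ~ tpeq n e e'].
    apply: contrapT => N'; apply: N; exists k => e e' E E' C; apply: contrapT => T.
    by apply: N'; exists e, e'.
  have [e0 [e0' [E0 E0' [_]]]] := N0 0; apply => k.
  have [e [e' [E E' [C _]]]] := N0 k.
  have /(_ k) -> : tpeq n e0 e by apply: Hcl; rewrite E0 E.
  by have /(_ k) -> : tpeq n e0' e' by apply: Hcl; rewrite E0' E'.
exists (\max_p K p) => e e' C; apply: (HK (cl e, cl e')) => //.
exact: code_le (leq_bigmax _) C.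
Qed.

Lemma fintypes_gprod (J : finType) (X : J -> bstruct) :
  (forall j, fintypes (X j)) -> fintypes (gprod X).
Proof.
move=> H n; have /choice[K HK] j : exists k, forall e e' : nat -> X j,
  code k n e = code k n e' -> tpeq n e e' by apply: (proj1 (fintypesP _) (H j)).
pose k := \max_j K j.
exists {ffun J -> htype k n}, (fun e => [ffun j => code k n (e^~ j)]) => e e' /ffunP E l.
apply: gprod_code => j; apply: HK; have := E j; rewrite !ffunE.
exact: code_le (leq_bigmax _).
Qed.

Lemma fintypes_gsum (I : finType) (i0 : I) (X : I -> bstruct) :
  (forall i, fintypes (X i)) -> fintypes (gsum i0 X).
Proof.
move=> H n; have /choice[K HK] j : exists k, forall e e' : nat -> X j,
  code k n e = code k n e' -> tpeq n e e' by apply: (proj1 (fintypesP _) (H j)).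
pose k := \max_j K j.
pose f (e : nat -> gsum i0 X) i j : X i :=
  if pselect (projT1 (e j) = i) is left E then eq_rect _ X (projT2 (e j)) i E else pt (X i).
have fP e j : e j = existT _ (projT1 (e j)) (f e (projT1 (e j)) j).
  by rewrite /f; case: pselect => // E; rewrite (Prop_irrelevance E erefl) /=; case: (e j).
exists ({ffun 'I_n -> I} * {ffun I -> htype k n})%type,
  (fun e : nat -> gsum i0 X => ([ffun j : 'I_n => projT1 (e j)], [ffun i => code k n (f e i)])).
move=> e e' [/ffunP E1 /ffunP E2] l.
apply: (gsum_code (f := f e) (f' := f e')) => [i|j ltj].
  apply: HK; have := E2 i; rewrite !ffunE; exact: code_le (leq_bigmax _).
exists (projT1 (e j)); split; first exact: fP.
have := E1 (Ordinal ltj); rewrite !ffunE /= => ->; exact: fP.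
Qed.

Lemma fintypes_elemeq (X Y : bstruct) : elemeq X Y -> fintypes X -> fintypes Y.
Proof.
move=> /elemeq_sym YX /fintypesP H; apply/fintypesP => n; have [k Hk] := H n.
exists k => e e' E l; have [d Hd] := elemeq_ex (maxn k l) n e YX.
have [d' Hd'] := elemeq_ex (maxn k l) n e' YX.
rewrite (code_le (leq_maxr k l) Hd) (code_le (leq_maxr k l) Hd'); apply: Hk.
by rewrite -(code_le (leq_maxl k l) Hd) -(code_le (leq_maxl k l) Hd').
Qed.

(** An answer at the rank that determines the types of [n.+1]-tuples is correct at all ranks, so
    equality of types is a back-and-forth system. *)
Lemma fintypes_pi (X Y Z : bstruct) : fintypes X -> elemeq Y X -> elemeq Z X ->
  pi 0 (fun=> pt Y) (fun=> pt Z).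
Proof.
move=> /fintypesP H YX ZX.
have T n : exists k, forall (e : nat -> Y) (e' : nat -> Z),
    code k n e = code k n e' -> tpeq n e e'.
  have [k Hk] := H n; exists k => e e' E l.
  have [d Hd] := elemeq_ex (maxn k l) n e YX.
  have [d' Hd'] := elemeq_ex (maxn k l) n e' ZX.
  rewrite (code_le (leq_maxr k l) Hd) (code_le (leq_maxr k l) Hd'); apply: Hk.
  by rewrite -(code_le (leq_maxl k l) Hd) -(code_le (leq_maxl k l) Hd').
exists (fun n e e' => tpeq n e e'); split; last exact: elemeq_trans YX (elemeq_sym ZX).
move=> n e e' E; have [k Hk] := T n.+1; have /codeSP[E1 E2] := E k.+1.
split=> [|x|y]; first exact: E.
  by have [y Hy] := E1 x; exists y; apply: Hk.
by have [x Hx] := E2 y; exists x; apply: Hk.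
Qed.

Lemma fintypes_finite (X : bstruct) : finite_set [set: X] -> fintypes X.
Proof.
move=> [N]; rewrite card_eq_le => /andP[/pcard_leP[f] _] n.
have flt x : f x < N := @funS _ _ _ _ f x I.
have finj x y : f x = f y -> x = y by apply: (@inj _ _ _ f); rewrite inE.
exists {ffun 'I_n -> option 'I_N}, (fun e => [ffun j : 'I_n => insub (f (e j))]).
move=> e e' /ffunP E k; apply: code_ext => j ltj.
have := E (Ordinal ltj); rewrite !ffunE /=.
have ins x : insub (f x) = Some (Ordinal (flt x)) by apply: insubT.
by rewrite !ins => -[/finj].
Qed.

(** All types realized in the countable model [Y] are principal, since [Y] is isomorphic to a model
    omitting the nonprincipal ones. A compactness argument then bounds the ranks that isolate
    them. *)
Lemma fintypes_unique (A : bstruct) :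
  (forall Y Z : bstruct, countable [set: Y] -> countable [set: Z] ->
     elemeq Y A -> elemeq Z A -> iso Y Z) -> fintypes A.
Proof.
move=> HA; have [Y [e0 [Yc YA0]]] := downward_LS 0 (fun=> pt A).
have YA : elemeq Y A := elemeq_of_tpeq YA0.
have Ypr n (e : nat -> Y) : principal n e.
  apply: contrapT => NP; have [Z [Zc ZY ZO]] := omit_all Yc.
  have [h [bh hr]] := HA _ _ Yc Zc YA (elemeq_trans ZY YA).
  apply: (ZO n e NP (h \o e)); apply: lpi_tpeq => //.
  exact: lpi_sym (cemb_lpi _ _ (iso_cemb bh hr)).
apply: (fintypes_elemeq YA).
apply/fintypesP => n; apply: contrapT => N.
have {N} N k : exists p : (nat -> Y) * (nat -> Y), code k n p.1 = code k n p.2 /\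
    ~ tpeq n p.1 p.2.
  apply: contrapT => N'; apply: N; exists k => e e' E; apply: contrapT => T.
  by apply: N'; exists (e, e').
have /choice[b Hb] := N.
(* A limit of tuples, each of which has a partner of another type agreeing with it up to a growing
   rank. Its type is realized in [Y], hence isolated at some rank [k]; but for some [i] at least [k]
   both members of [b i] have the isolating code. *)
pose c j : upow Y := cls (fun k => (b k).1 j).
have [Z [e [Zc He]]] := downward_LS n c.
have ZA : elemeq Z A.
  exact: elemeq_trans (elemeq_of_tpeq He) (elemeq_trans (elemeq_upow Y) YA).
have [h [bh hr]] := HA _ _ Zc Yc ZA YA.
have T : tpeq n (h \o e) c.
  apply: tpeq_trans He; apply: lpi_tpeq; first exact: elemeq_trans YA (elemeq_sym ZA).
  exact: lpi_sym (cemb_lpi _ _ (iso_cemb bh hr)).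
have [k Hk] := Ypr n (h \o e).
have := T k; move/esym/los => /(ultra_and (ultra_ge k)) /ultra_ex[i [lei Ei]].
have [C D] := Hb i; apply: D.
apply: tpeq_trans (Hk _ Ei) (tpeq_sym (Hk _ _)).
by rewrite -Ei; symmetry; apply: code_le lei C.
Qed.

(** * Components as structures of their own *)

Definition component (W : bstruct) (x : W) : bstruct := substr (conn_refl x).

Lemma component_cemb (W : bstruct) (x : W) : @cemb (component x) W (@proj1_sig _ _).
Proof.
split=> // [|[y xy] z /= yz]; first exact: proj1_sig_inj.
by exists (exist _ z (conn_edge xy yz)).
Qed.

(** The distances from [x] to the points [c i] are finite but not bounded beforehand; agreement of
    [x] and [y] at all ranks pays for every walk. *)
Lemma code_reach_tuple (X Y : bstruct) (x : X) (y : Y) k l (c : nat -> X) :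
  tpeq 1 (fun=> x) (fun=> y) -> (forall i, conn x (c i)) ->
  exists d : nat -> Y, (forall i, conn y (d i)) /\ code l k c = code l k d.
Proof.
move=> xy xc.
suff [d [D H]] : exists d : nat -> Y, (forall i, conn y (d i)) /\
    code l k.+1 (fun i => if i < k then c i else x) =
    code l k.+1 (fun i => if i < k then d i else y).
  exists d; split=> //; apply: code_sub H => i lti; exists i; rewrite lti.
  by split=> //; apply: ltnW.
elim: k l => [|k IHk] l; first by exists (fun=> y); split; [move=> _; apply: conn_refl | apply: xy].
have [p kp] := xc k; have [d [D /(@code_reach _ _ _ _ _ _ _ k (c k) (ltnSn k))]] := IHk (l + p).
rewrite ltnn => /(_ kp)[c' [yc' H]].
exists (fun i => if i < k then d i else c'); split.
  by move=> i; case: ltnP => // _; exists p.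
apply: code_sub H => i lti; have [ik|ik|ik] := ltngtP i k.
- have ik' : i < k.+1 by lia.
  by exists i.+1; rewrite /= ik ik'.
- have ik' : i < k.+1 = false by lia.
  by exists k.+1; rewrite /= ltnn ik'.
- by exists 0; rewrite ik ltnSn.
Qed.

(** Points of [upow (component x)] are sequences of points at possibly unbounded distances from [x].
    At coordinate [l] they are matched up to rank [l] by points reachable from [x']. In [upow W]
    both tuples then have one type, hence are locally equivalent, and this is pulled back to the
    ultrapowers of the two components. *)
Lemma component_mult (W : bstruct) (x x' : W) (Z : bstruct) (z : Z) k :
  tpeq 1 (fun=> x) (fun=> x') -> mult (upow (component x)) z k -> mult (upow (component x')) z k.
Proof.
move=> xx' [w [W1 W2]].
have /choice[d Hd] l : exists d : nat -> component x',
    code l k (fun i => proj1_sig (rep (w i) l)) = code l k (fun i => proj1_sig (d i)).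
  have [|d [D E]] := @code_reach_tuple _ _ x x' k l (fun i => proj1_sig (rep (w i) l)) xx'.
    by move=> i; apply: (proj2_sig (rep (w i) l)).
  by exists (fun i => exist _ (d i) (D i)).
pose v i : upow (component x') := cls (fun l => d l i).
pose w' i : upow W := cls (fun l => proj1_sig (rep (w i) l)).
pose v' i : upow W := cls (fun l => proj1_sig (d l i)).
have Lw : lpi k w w'.
  have -> : w = fun i => cls (rep (w i)) by apply/funext => i; rewrite repK.
  by apply: lpi_upow; apply: ultra_all => l; apply: cemb_lpi (component_cemb x).
have Lv : lpi k v v'.
  by apply: lpi_upow; apply: ultra_all => l; apply: cemb_lpi (component_cemb x').
have Lwv : lpi k w' v'.
  apply: pi_lpi; apply: pi_upow => p; symmetry; apply/los.
  have := erefl (code p k w'); move/los => H.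
  apply: (ultra_mono (ultra_and H (ultra_ge p))) => l /= [<- lep].
  by symmetry; apply: code_le lep (Hd l).
have L := lpi_trans Lw (lpi_trans Lwv (lpi_sym Lv)).
exists v; split=> [i j lti ltj ij|i lti]; last first.
  split=> //; apply: alike_trans (proj1 (W2 i lti)).
  exact: alike_sym (lpi_alike L lti).
by move=> h; apply: (W1 i j) => //; apply/(lpi_connE L).
Qed.

(** A component need not be definable in [W], so the game on [W] does not restrict to it. The two
    components are compared through their ultrapowers, which have equal multiplicities. *)
Lemma component_elemeq (W : bstruct) (x x' : W) :
  tpeq 1 (fun=> x) (fun=> x') -> elemeq (component x) (component x').
Proof.
move=> xx'; apply: elemeq_trans (elemeq_sym (elemeq_upow _)) _.
apply: elemeq_trans (elemeq_upow (component x')).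
apply: pi_tpeq; apply: lpi_pi => [y k|y k|]; last exact: lpi0.
  exact: component_mult.
exact: component_mult (tpeq_sym xx').
Qed.

(** * Continuum many models from a sum *)

Lemma cemb_comp (X Y Z : bstruct) (g : X -> Y) (h : Y -> Z) :
  cemb g -> cemb h -> cemb (h \o g).
Proof.
move=> [ginj gr gc] [hinj hr hc]; split=> [|x y|x z /= /[dup] xz /hc[y E]].
- exact: inj_comp.
- by rewrite gr hr.
have : edge (g x) y by move: xz; rewrite -E /edge !hr.
by move=> /gc[x' E']; exists x'; rewrite /= E'.
Qed.

Lemma countable_val (T : Type) : countable [set: T] -> exists f : T -> nat, injective f.
Proof. by move=> /countable_injP[f finj]; exists f => x y; apply: finj; rewrite inE. Qed.

Lemma inj_countable (T : Type) (f : T -> nat) : injective f -> countable [set: T].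
Proof. by move=> finj; apply/countable_injP; exists f => x y _ _; apply: finj. Qed.

Lemma gsum_countable (I : Type) (i0 : I) (X : I -> bstruct) :
  countable [set: I] -> (forall i, countable [set: X i]) -> countable [set: gsum i0 X].
Proof.
move=> /countable_val[f finj] Xc.
have /dchoice[g ginj] i : exists g : X i -> nat, injective g by apply: countable_val.
apply: (@inj_countable _ (fun a : gsum i0 X => pickle (f (projT1 a), g (projT1 a) (projT2 a)))).
move=> [i x] [j y] /(pcan_inj pickleK) /= [/finj E]; subst j.
by move=> /ginj ->.
Qed.

Lemma substr_countable (V : bstruct) (P : V -> Prop) v (Pv : P v) :
  countable [set: V] -> countable [set: substr Pv].
Proof.
move=> /countable_val[f finj]; apply: (@inj_countable _ (f \o @proj1_sig _ _)).
by apply: inj_comp => //; apply: proj1_sig_inj.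
Qed.

Definition osum (M : bstruct) (J : Type) (Q : J -> bstruct) : bstruct :=
  gsum None (fun o : option J => if o is Some j then Q j else M).

Definition oinl (M : bstruct) (J : Type) (Q : J -> bstruct) (x : M) : osum M Q :=
  existT _ None x.

Definition oinr (M : bstruct) (J : Type) (Q : J -> bstruct) j (x : Q j) : osum M Q :=
  existT _ (Some j) x.

Arguments oinl M {J} Q x.
Arguments oinr M {J} Q j x.

Lemma oinl_cemb (M : bstruct) (J : Type) (Q : J -> bstruct) : cemb (oinl M Q).
Proof. exact: (@gsum_cemb _ None (fun o : option J => if o is Some j then Q j else M) None). Qed.

Lemma oinr_cemb (M : bstruct) (J : Type) (Q : J -> bstruct) j : cemb (oinr M Q j).
Proof.
exact: (@gsum_cemb _ None (fun o : option J => if o is Some j then Q j else M) (Some j)).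
Qed.

Lemma oinr_alike (M : bstruct) (J : Type) (Q : J -> bstruct) j (x : Q j) :
  alike x (oinr M Q j x).
Proof. exact: cemb_alike (oinr_cemb M Q j). Qed.

Lemma component_alike (W : bstruct) (x : W) (c : component x) : alike (proj1_sig c) c.
Proof. exact: alike_sym (cemb_alike c (component_cemb x)). Qed.

Lemma osumP (M : bstruct) (J : Type) (Q : J -> bstruct) (a : osum M Q) :
  (exists x, oinl M Q x = a) \/ (exists j x, oinr M Q j x = a).
Proof. by case: a => -[j|] x; [right; exists j, x | left; exists x]. Qed.

Lemma oinlr (M : bstruct) (J : Type) (Q : J -> bstruct) x j y :
  oinl M Q x <> oinr M Q j y.
Proof. by move/(congr1 (@projT1 _ _)). Qed.

Lemma osum_elemeq (M M' : bstruct) (J : Type) (Q Q' : J -> bstruct) :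
  elemeq M M' -> (forall j, elemeq (Q j) (Q' j)) -> elemeq (osum M Q) (osum M' Q').
Proof. by move=> MM' QQ'; apply: gsum_elemeq => -[j|]; [apply: QQ' | apply: MM']. Qed.

Lemma osum_countable (M : bstruct) (J : Type) (Q : J -> bstruct) :
  countable [set: J] -> countable [set: M] -> (forall j, countable [set: Q j]) ->
  countable [set: osum M Q].
Proof.
move=> /countable_val[f finj] Mc Qc; apply: gsum_countable => [|[j|]//].
apply: (@inj_countable _ (fun o => if o is Some j then (f j).+1 else 0)).
by move=> [j|] [l|] //= [/finj ->].
Qed.

Lemma cemb_range_conn (X Y : bstruct) (h : X -> Y) (y z : Y) : cemb h ->
  conn y z -> (exists x, h x = y) -> exists x, h x = z.
Proof.
move=> hc yz [x E]; subst y; case: yz => d; elim: d z => [|d IHd] z /=.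
  by move=> <-; exists x.
by move=> [u [/IHd[x' <-] uz]]; case: hc => _ _; apply; eauto.
Qed.

Lemma cemb_mult_le (X Y : bstruct) (h : X -> Y) (Z : bstruct) (z : Z) k :
  cemb h -> mult X z k -> mult Y z k.
Proof.
by move=> hc /(cemb_mult _ _ hc)[w [W1 W2]]; exists w; split=> // i /W2[].
Qed.

(** The version of [alike] that forgets the base points. *)
Definition same (W : bstruct) (x y : W) : Prop := exists u, conn x u /\ alike u y.

Lemma same_refl (W : bstruct) (x : W) : same x x.
Proof. by exists x; split; [apply: conn_refl | apply: alike_refl]. Qed.

Lemma same_sym (W : bstruct) (x y : W) : same x y -> same y x.
Proof.
move=> [u [xu uy]]; have [v [yv xv]] := alike_conn uy (conn_sym xu).
by exists v; split=> //; apply: alike_sym.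
Qed.

Lemma same_trans (W : bstruct) (x y z : W) : same x y -> same y z -> same x z.
Proof.
move=> [u [xu uy]] [v [yv vz]]; have [u' [uu' vu']] := alike_conn (alike_sym uy) yv.
exists u'; split; first exact: conn_trans uu'.
exact: alike_trans (alike_sym vu') vz.
Qed.

Lemma mult_same (W Y : bstruct) (x y : W) k : same x y -> mult Y x k -> mult Y y k.
Proof. by move=> [u [xu uy]] /(mult_conn xu); apply: multP_alike. Qed.

Definition many_models (X : bstruct) : Prop := exists F : (nat -> bool) -> bstruct,
  [/\ forall t, countable [set: F t], forall t, elemeq (F t) X &
    forall t u, iso (F t) (F u) -> t = u].

Lemma mult_max (Y : bstruct) (P : Y -> Prop) (Z : bstruct) (z : Z) k :
  ~ multP P z k -> exists q, multP P z q /\ ~ multP P z q.+1.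
Proof.
elim: k => [|k IHk] N; first by case: N; apply: multP0.
by have [M|/IHk//] := pselect (multP P z k); exists k.
Qed.

(** The added components already occur infinitely often in [W], so no multiplicity changes. *)
Lemma absorb (W : bstruct) (J : Type) (x : J -> W) :
  (forall j k, mult W (x j) k) -> elemeq (osum W (fun j => component (x j))) W.
Proof.
pose Q j := component (x j); rewrite -/Q => H; have hc := oinl_cemb W Q.
apply: pi_tpeq; apply: lpi_pi => [s k [w [W1 W2]]|y k|]; last exact: lpi0.
  have [[i [lti [j [c E]]]]|N] := pselect (exists i, i < k /\
      exists j (c : Q j), oinr W Q j c = w i).
    have xc : conn (x j) (proj1_sig c) := proj2_sig c.
    apply: multP_alike (mult_conn xc (H j k)).
    apply: alike_trans (component_alike c) _.
    apply: alike_trans (proj1 (W2 i lti)).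
    by rewrite -E; exact: (@oinr_alike W J Q j c).
  apply/(cemb_mult _ _ hc); exists w; split=> // i lti; split; first by case: (W2 i lti).
  by case: (osumP (w i)) => // h; case: N; exists i.
exact: cemb_mult_le hc.
Qed.

(** To [W0] is added one copy of the component of [z n] for each [n] with [t n]. The multiplicity of
    [z n], finite in [W0], grows by one exactly for these [n], so [t] can be recovered. The theory
    stays that of [W], which absorbs the elementarily equivalent components of the [x n]. *)
Lemma many_sums (W W0 : bstruct) (x z : nat -> W) :
  countable [set: W] -> countable [set: W0] -> elemeq W0 W ->
  (forall n k, mult W (x n) k) -> (forall n, elemeq (component (z n)) (component (x n))) ->
  (forall n, exists k, ~ mult W0 (z n) k) -> (forall m n, same (z m) (z n) -> m = n) ->
  many_models W.
Proof.
move=> Wc W0c W0W xinf zx zfin zz.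
pose Q (t : nat -> bool) (n : {n | t n}) := component (z (val n)).
pose F (t : nat -> bool) := osum W0 (@Q t).
have FP t n q : mult W0 (z n) q -> ~ mult W0 (z n) q.+1 ->
    mult (F t) (z n) q.+1 <-> t n.
  move=> M0 M1; have hc := oinl_cemb W0 (@Q t).
  split=> [[w [W1 W2]]|tn].
    apply: contrapT => ntn; apply: M1; apply/(cemb_mult _ _ hc).
    exists w; split=> // i lti; have [wz _] := W2 i lti; split=> //.
    case: (osumP (w i)) => // -[[m tm] [c E]].
    suff mn : m = n by move: ntn; rewrite -mn tm.
    apply: zz; exists (proj1_sig c); split; first exact: (proj2_sig c).
    apply: alike_trans (component_alike c) _.
    by apply: alike_trans wz; rewrite -E; exact: (@oinr_alike _ _ (@Q t) _ c).
  rewrite -addn1; apply: (multP_join (P := fun y => exists x, oinl W0 (@Q t) x = y)).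
  - by move=> a b; apply: cemb_range_conn.
  - by apply/(cemb_mult _ _ hc).
  pose c : component (z n) := exist _ (z n) (conn_refl _).
  exists (fun=> oinr W0 (@Q t) (exist _ n tn) c).
  split=> [|i _]; first by lia.
  split; last by move=> [y E]; exact: (oinlr E).
  exact: alike_trans (alike_sym (@oinr_alike W0 _ (@Q t) (exist _ n tn) c))
    (alike_sym (component_alike c)).
exists F; split=> [t|t|t u [h [bh hr]]].
- apply: osum_countable; [|exact: W0c|by move=> j; apply: substr_countable].
  by apply: (@inj_countable _ (@proj1_sig _ _)); apply: proj1_sig_inj.
- apply: elemeq_trans (absorb (x := fun n : {n | t n} => x (val n)) _); last by move=> [n tn].
  by apply: osum_elemeq => // -[n tn]; apply: zx.
apply/funext => n; have [k /mult_max[q [M0 M1]]] := zfin n.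
apply/idP/idP => /(FP _ _ _ M0 M1) M; apply/(FP _ _ _ M0 M1).
  exact: cemb_mult_le (iso_cemb bh hr) M.
have [g [bg gr]] : iso (F u) (F t) by apply: iso_sym; exists h.
exact: cemb_mult_le (iso_cemb bg gr) M.
Qed.

(** Otherwise a greedy choice produces an infinite sequence of pairwise different components to
    which [many_sums] applies. *)
Lemma few_sums (W W0 : bstruct) : countable [set: W] -> countable [set: W0] ->
  elemeq W0 W -> ~ many_models W ->
  exists E : seq W, forall x z : W, (forall k, mult W x k) -> elemeq (component z) (component x) ->
    (exists k, ~ mult W0 z k) -> exists e, List.In e E /\ same e z.
Proof.
move=> Wc W0c W0W NM; apply: contrapT => N.
have /choice[f Hf] E : exists p : W * W, [/\ forall k, mult W p.1 k,
    elemeq (component p.2) (component p.1), exists k, ~ mult W0 p.2 k &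
    forall e, List.In e E -> ~ same e p.2].
  apply: contrapT => N'; apply: N; exists E => x z H1 H2 H3; apply: contrapT => N''.
  by apply: N'; exists (x, z); split=> // e eE ez; apply: N''; exists e.
pose L := fix L n := if n is m.+1 then (f (L m)).2 :: L m else [::].
have LP m n : m < n -> List.In (f (L m)).2 (L n).
  elim: n => // n IHn; rewrite ltnS leq_eqVlt => /orP[/eqP -> |/IHn]; [by left | by right].
apply: NM; apply: (@many_sums W W0 (fun n => (f (L n)).1) (fun n => (f (L n)).2)) => //.
- by move=> n; case: (Hf (L n)).
- by move=> n; case: (Hf (L n)).
- by move=> n; case: (Hf (L n)).
move=> m n h; have [mn|nm|//] := ltngtP m n.
  by case: (Hf (L n)) => _ _ _ /(_ _ (LP _ _ mn)).
by case: (Hf (L m)) => _ _ _ /(_ _ (LP _ _ nm)) []; apply: same_sym.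
Qed.

(** The tuples may be spread over several copies of the component: counting copies uses the types of
    such tuples. *)
Definition good (W : bstruct) (z : W) : Prop :=
  forall n (a : nat -> W), (forall i, i < n -> same z (a i)) -> principal n a.

Lemma good_same (W : bstruct) (z z' : W) : same z z' -> good z -> good z'.
Proof. by move=> zz' H n a Ha; apply: H => i /Ha; apply: same_trans. Qed.

(** If [W0] had unboundedly many copies of the component, every tuple spread over such copies in [W]
    could be reproduced in [W0] with the same type, whereas [W0] omits the nonprincipal ones. *)
Lemma not_good (W W0 : bstruct) (z : W) : elemeq W0 W ->
  (forall n (a : nat -> W), ~ principal n a -> forall e : nat -> W0, ~ tpeq n e a) ->
  ~ good z -> exists k, ~ mult W0 z k.
Proof.
move=> W0W O NG; apply: contrapT => N; apply: NG => n a za; apply: contrapT => NP.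
have {N} M k : mult W0 z k by apply: contrapT => ?; apply: N; exists k.
suff [a' L] : exists a' : nat -> W0, lpi n a a'.
  by apply: (O n a NP a'); apply: tpeq_sym; apply: lpi_tpeq => //; apply: elemeq_sym.
elim: n za {NP} => [|n IHn] za; first by exists (fun=> pt W0); apply: lpi0.
have [i lti|a' L] := IHn; first by apply: za; apply: ltnW.
suff [y Hy] : exists y, lpi n.+1 (a n .: a) (y .: a').
  exists (fun i => if i < n then a' i else y); apply: lpi_sub Hy => i lti.
  have [ltin|lein] := ltnP i n; first by exists i.+1.
  by exists 0; split=> //=; congr a; lia.
have [[i [lti ian]]|N] := pselect (exists i, i < n /\ conn (a i) (a n)).
  by have [y [_ Hy]] := lpi_conn L lti ian; exists y.
have [w [W1 W2]] := M n.+1.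
have [|l ltl Hl] := @untouched _ w n.+1 n finset.setT a' W1; first by rewrite cardsT card_ord.
have [wz _] := W2 l ltl; have [u [zu ua]] := za n (ltnSn n).
have [y [wy uy]] := alike_conn (alike_sym wz) zu.
exists y; apply: lpi_far => // [i lti ian|i lti iy|].
- by apply: N; exists i.
- apply: (Hl (Ordinal lti)); first by rewrite finset.inE.
  exact: conn_trans iy (conn_sym wy).
exact: alike_trans (alike_sym ua) uy.
Qed.

(** An answer at the isolating rank has the right type, so equality of types is a local system on
    the two components. *)
Lemma good_alike (W : bstruct) (z z' : W) : good z -> good z' ->
  tpeq 1 (fun=> z) (fun=> z') -> alike z z'.
Proof.
move=> Gz Gz' zz'.
exists (fun n (e e' : nat -> W) => [/\ tpeq n e e', forall i, i < n -> conn z (e i) &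
  forall i, i < n -> conn z' (e' i)]); split; last first.
  by split=> // i _; apply: conn_refl.
have csame (a b : W) : conn a b -> same a b.
  by move=> ab; exists b; split=> //; apply: alike_refl.
have sc (a y : W) n (f : nat -> W) : conn a y -> (forall i, i < n -> conn a (f i)) ->
    forall i, i < n.+1 -> conn a ((y .: f) i).
  by move=> ay Hf [|i] lti //=; apply: Hf.
move=> n e e' [T C C']; split=> [|i x lti ix|i y lti iy]; first exact: T.
  have zx : conn z x := conn_edge (C i lti) ix.
  have [i' lti'|k Hk] := Gz n.+1 (x .: e); first exact/csame/(sc _ _ _ _ zx C).
  have /codeSP[/(_ x)[y /esym/Hk/tpeq_sym Hy] _] := T k.+1.
  exists y; split=> //; first exact: sc.
  apply: sc => //; apply: conn_edge (C' i lti) _.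
  exact: (@code0_edge _ _ _ _ _ i.+1 0 (Hy 0)).
have zy : conn z' y := conn_edge (C' i lti) iy.
have [i' lti'|k Hk] := Gz' n.+1 (y .: e'); first exact/csame/(sc _ _ _ _ zy C').
have /codeSP[_ /(_ y)[x /Hk Hx]] := T k.+1.
exists x; split=> //; last exact: sc.
apply: sc => //; apply: conn_edge (C i lti) _.
exact: (@code0_edge _ _ _ _ _ i.+1 0 (esym (Hx 0))).
Qed.

(* Points of [M] in [k] distinct components are mirrored by points of the
   ultrapower of [M'], and the type of the former in [W], being principal, is
   then realized by points of [M'] itself. *)
Lemma good_mult (W M M' : bstruct) (h : M -> W) (h' : M' -> W) (x : W) k :
  cemb h -> cemb h' -> elemeq M M' -> good x ->
  (forall v : W, tpeq 1 (fun=> v) (fun=> x) -> good v) ->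
  mult M x k -> mult M' x k.
Proof.
move=> hc hc' MM' Gx Gv [w [W1 W2]].
have MMu : elemeq (upow M) (upow M').
  exact: elemeq_trans (elemeq_trans (elemeq_upow M) MM') (elemeq_sym (elemeq_upow M')).
have [d Hd] := pi_ex k (fun j => cls (fun=> w j) : upow M) (pi_upow MMu).
pose d' j : upow W := cls (fun l => h' (rep (d j) l)).
have L1 : lpi k (fun j => cls (fun=> w j) : upow M) (fun j => cls (fun=> h (w j)) : upow W).
  by apply: lpi_upow; apply: ultra_all => l; apply: cemb_lpi.
have L2 : lpi k d d'.
  have -> : d = (fun j => cls (rep (d j))) by apply/funext => j; rewrite repK.
  by apply: lpi_upow; apply: ultra_all => l; apply: cemb_lpi.
have T : tpeq k d' (h \o w).
  apply: tpeq_trans (los_const k (h \o w)); apply: lpi_tpeq => //.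
  exact: lpi_trans (lpi_sym L2) (lpi_trans (lpi_sym (pi_lpi Hd)) L1).
have wx i : i < k -> alike (h (w i)) x.
  by move=> lti; apply: alike_trans (alike_sym (cemb_alike _ hc)) (proj1 (W2 i lti)).
have [i lti|p Hp] := Gx k (h \o w).
  by apply: same_sym; exists (h (w i)); split; [apply: conn_refl | apply: wx].
have := T p; move/los/ultra_ex => [l /Hp {}T].
exists (fun j => rep (d j) l); split=> [i j lti ltj ij c|i lti]; last first.
  split=> //; apply: alike_trans (cemb_alike _ hc') _.
  have Ti : tpeq 1 (fun=> h' (rep (d i) l)) (fun=> x).
    apply: (@tpeq_trans _ W _ _ _ (fun=> h (w i))); last by apply: lpi_tpeq => //; apply: wx.
    by apply: tpeq_sub T => j _; exists i.
  by apply: good_alike => //; apply: Gv.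
apply: (W1 i j) => //; apply/(cemb_conn _ _ hc).
by apply: (tpeq_conn T lti ltj); apply/(cemb_conn _ _ hc').
Qed.

(* The exceptional components are those in [E], which may be repeated finitely
   often in [W0], and the [r e]: a good [x] with a bad point of its type in the
   component of [e] is determined by [e] up to [same]. *)
Lemma finite_invariants (W : bstruct) : countable [set: W] -> ~ many_models W ->
  exists E : seq W, forall (M M' : bstruct) (h : M -> W) (h' : M' -> W),
    countable [set: M] -> countable [set: M'] -> cemb h -> cemb h' -> elemeq M M' ->
    (forall (x : W) k, multP (fun y => ~ exists a, h a = y) x k <->
                       multP (fun y => ~ exists a, h' a = y) x k) ->
    (forall e, List.In e E -> forall k, mult M e k <-> mult M' e k) -> iso M M'.
Proof.
move=> Wc NM; have [W0 [W0c W0W O]] := omit_all Wc.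
have [E HE] := few_sums Wc W0c W0W NM.
have NG z := @not_good W W0 z W0W O.
pose P (e x : W) := good x /\ exists u, conn e u /\ tpeq 1 (fun=> u) (fun=> x).
have /choice[r Hr] e : exists x, forall y, P e y -> P e x.
  by have [[x Px]|N] := pselect (exists x, P e x); [exists x | exists e => y Py; case: N; exists y].
exists (List.app E (List.map r E)) => M M' h h' Mc Mc' hc hc' MM' rest inv.
have csame (a b : W) : conn a b -> same a b.
  by move=> ab; exists b; split=> //; apply: alike_refl.
(* A path joins [u] to [v] in the component of [e]. Copied from [x] at the isolating rank of [y], it
   ends at a point with the type of [y]. *)
have Psame e x y : P e x -> P e y -> same x y.
  move=> [Gx [u [eu ux]]] [Gy [v [ev vy]]].
  have [k Hk] : principal 1 (fun=> y) by apply: Gy => i _; apply: same_refl.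
  have [d uv] : conn u v := conn_trans (conn_sym eu) ev.
  have [c [xc Hc]] := @code_reach _ _ k d 1 (fun=> u) (fun=> x) 0 v isT uv (ux _).
  have xc' : conn x c by exists d.
  exists c; split=> //; apply: good_alike => //; first exact: good_same (csame _ _ xc') Gx.
  apply: Hk; rewrite -vy; symmetry; apply: code_sub Hc => i _; by exists 0.
(* For a component repeated infinitely often in [W], either all points with the type of [x] are
   good, and the theory fixes its multiplicity, or it is one of the listed exceptions. *)
have inf x : (forall k, mult W x k) ->
    (good x /\ forall v : W, tpeq 1 (fun=> v) (fun=> x) -> good v) \/
    exists e, List.In e (List.app E (List.map r E)) /\ same e x.
  move=> xinf; have [Gx|NGx] := pselect (good x); last first.
    have [e [eE ex]] := HE x x xinf (elemeq_refl _) (NG _ NGx).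
    by right; exists e; split=> //; apply/List.in_app_iff; left.
  have [Gv|] := pselect (forall v : W, tpeq 1 (fun=> v) (fun=> x) -> good v).
    by left.
  move=> /existsNP[v /not_implyP[vx NGv]]; right.
  have [e [eE [u [eu uv]]]] := HE x v xinf (component_elemeq vx) (NG _ NGv).
  have Pex : P e x.
    by split=> //; exists u; split=> //; apply: tpeq_trans vx; apply: lpi_tpeq.
  exists (r e); split; last exact: Psame (Hr _ _ Pex) Pex.
  by apply/List.in_app_iff; right; apply: List.in_map.
have key (N N' : bstruct) (g : N -> W) (g' : N' -> W) : cemb g -> cemb g' -> elemeq N N' ->
    (forall (x : W) k, multP (fun y => ~ exists a, g a = y) x k <->
                       multP (fun y => ~ exists a, g' a = y) x k) ->
    (forall e, List.In e (List.app E (List.map r E)) -> forall k, mult N e k -> mult N' e k) ->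
    forall (x : W) k, mult N x k -> mult N' x k.
  move=> gc gc' NN' grest ginv x k Nx.
  (* If exactly [q] copies lie outside the image of [g], then [W] has at least [k + q], of which at
     most [q] lie outside the image of [g']; so [k] lie inside. With unboundedly many outside, [inf]
     applies. *)
  have [[q /mult_max[{}q [Q0 Q1]]]|restinf] :=
    pselect (exists q, ~ multP (fun y => ~ exists a, g a = y) x q).
    have := multP_join (fun a b => @cemb_range_conn _ _ g a b gc)
      (proj1 (cemb_mult _ _ gc) Nx) Q0.
    move=> /(multP_split (fun y => exists a, g' a = y))[i [j [Eij Mi /grest Mj]]].
    have leqj : j <= q by rewrite leqNgt; apply/negP => ?; apply: Q1; apply: multP_le Mj.
    by apply/(cemb_mult _ _ gc'); apply: multP_le Mi; lia.
  have xinf l : mult W x l.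
    have : multP (fun y => ~ exists a, g a = y) x l.
      by apply: contrapT => ?; apply: restinf; exists l.
    by move=> [w [W1 W2]]; exists w; split=> // i /W2[].
  have [[Gx Gv]|[e [eE ex]]] := inf x xinf; first exact: good_mult gc gc' NN' Gx Gv Nx.
  apply: (mult_same ex); apply: ginv => //; exact: (mult_same (same_sym ex)).
apply: (@pi_iso _ _ (fun=> pt M) (fun=> pt M')) => //.
apply: lpi_pi => [y k|y k|]; last exact: lpi0.
- move=> /(multP_alike (cemb_alike y hc)) H.
  apply: multP_alike (alike_sym (cemb_alike y hc)) _; apply: (key _ _ h h') H => // e eE l.
  exact: (proj1 (inv e eE l)).
- move=> /(multP_alike (cemb_alike y hc')) H.
  apply: multP_alike (alike_sym (cemb_alike y hc')) _; apply: (key _ _ h' h) H => //.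
  + by move=> x l; split=> /rest.
  + by move=> e eE l; apply: (proj2 (inv e eE l)).
Qed.

(* Koenig's argument that [nat -> bool], being in bijection with its countable
   power, is not a countable union of sets of smaller cardinality. *)
Lemma koenig (T : Type) (f : (nat -> bool) -> T) :
  (forall t0, exists c : (nat -> bool) -> nat, forall t u,
     f t = f t0 -> f u = f t0 -> c t = c u -> t = u) ->
  exists s : (nat -> bool) -> (nat -> bool), injective (f \o s).
Proof.
move=> H; have {H} [g Hg] : exists g : (nat -> bool) -> nat, forall t u,
    f t = f u -> g t = g u -> t = u.
  (* A representative of the fibre of [f] through [t], so that one enumeration serves the whole
     fibre. Afterwards [f] is injective on each class of [g]. *)
  pose b t := projT1 (cid (ex_intro (fun u => f u = f t) t erefl)).
  have fb t : f (b t) = f t by rewrite /b; case: cid.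
  have bE t u : f t = f u -> b t = b u.
    by move=> E; rewrite /b; move: (ex_intro _ t _) (ex_intro _ u _);
       rewrite E => p q; rewrite (Prop_irrelevance p q).
  have /choice[c Hc] := H.
  exists (fun t => c (b t) t) => t u E; rewrite -(bE _ _ E) => Ec.
  by apply: (Hc (b t)) => //; rewrite fb.
pose pr (n : nat) (t : nat -> bool) : nat -> bool := fun i => t (pickle (n, i)).
(* Some class of [g] is mapped onto [nat -> bool] by its projection: otherwise the missed values
   [d n] combine into one sequence, which contradicts the choice of [d] for its own class. *)
have [n Hn] : exists n, forall d, exists t, g t = n /\ pr n t = d.
  apply: contrapT => N.
  have /choice[d Hd] n : exists d, forall t, g t = n -> pr n t <> d.
    apply: contrapT => N'; apply: N; exists n => d; apply: contrapT => N''.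
    by apply: N'; exists d => t gt E; apply: N''; exists t.
  pose t i := if unpickle i is Some (n, j) then d n j else false.
  apply: (Hd (g t) t erefl); apply/funext => i.
  by rewrite /pr /t pickleK.
have /choice[s Hs] := Hn; exists s => d d' /= E.
have [gs <-] := Hs d; have [gs' <-] := Hs d'.
by congr pr; apply: Hg => //; rewrite gs gs'.
Qed.

(** As [g] is onto, all that lies outside the image of [M] comes from [Q], and [g'] carries a copy
    of [Q] outside the image of [M']. *)
Lemma rest_mult (M M' : bstruct) (J : Type) (Q : J -> bstruct) (W : bstruct)
    (g : osum M Q -> W) (g' : osum M' Q -> W) (Z : bstruct) (z : Z) k :
  cemb g -> (forall y, exists a, g a = y) -> cemb g' ->
  multP (fun y => ~ exists a, (g \o oinl M Q) a = y) z k ->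
  multP (fun y => ~ exists a, (g' \o oinl M' Q) a = y) z k.
Proof.
move=> gc gsurj gc' [w [W1 W2]].
have /choice[v Hv] i : exists v, i < k ->
    exists j q, g (oinr M Q j q) = w i /\ g' (oinr M' Q j q) = v.
  have [ltik|_] := ltnP i k; last by exists (pt W).
  have [a E] := gsurj (w i); have [[x Ex]|[j [q Eq]]] := osumP a.
    by case: (W2 i ltik) => _ []; exists x; rewrite /= Ex.
  by exists (g' (oinr M' Q j q)) => _; exists j, q; rewrite Eq.
exists v; split=> [i l lti ltl il|i lti].
  have [j [q [Ew <-]]] := Hv i lti; have [j' [q' [Ew' <-]]] := Hv l ltl.
  move=> /(cemb_conn _ _ gc') c; have [E] := gsum_conn c; simpl in E; subst j'.
  apply: (W1 i l) => //; rewrite -Ew -Ew'; apply/(cemb_conn _ _ gc).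
  apply/(cemb_conn _ _ (oinr_cemb M Q j)).
  exact/(cemb_conn _ _ (oinr_cemb M' Q j)).
have [j [q [Ew <-]]] := Hv i lti; split.
  apply: alike_trans (proj1 (W2 i lti)); rewrite -Ew.
  apply: alike_trans (alike_sym (cemb_alike _ gc')) _.
  apply: alike_trans (cemb_alike _ gc).
  exact: alike_trans (alike_sym (@oinr_alike M' J Q j q)) (@oinr_alike M J Q j q).
by move=> [x /=]; case: gc' => ginj _ _ /ginj; apply: oinlr.
Qed.

(** A fibre of [f] consists of the [t] with [M t + Q] in one isomorphism class. Inside it
    [finite_invariants] recovers [M t] from finitely many multiplicities, so fibres are countable
    and [koenig] applies. *)
Lemma many_osum (M : (nat -> bool) -> bstruct) (J : Type) (Q : J -> bstruct) (X : bstruct) :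
  countable [set: J] -> (forall j, countable [set: Q j]) ->
  (forall t, countable [set: M t]) -> (forall t u, elemeq (M t) (M u)) ->
  (forall t u, iso (M t) (M u) -> t = u) -> (forall t, elemeq (osum (M t) Q) X) -> many_models X.
Proof.
move=> Jc Qc Mc MM Minj YX; apply: contrapT => NM.
pose Y t := osum (M t) Q; have Yc t : countable [set: Y t] by apply: osum_countable.
pose f t : (nat -> bool) -> Prop := fun u => iso (Y t) (Y u).
have fE t u : iso (Y t) (Y u) -> f t = f u.
  move=> tu; apply/funext => v; apply/propext; split; apply: iso_trans => //.
  exact: iso_sym.
have [t0|s sinj] := @koenig _ f; last first.
  apply: NM; exists (fun t => Y (s t)); split=> [//|t|t u tu]; first exact: YX.
  by apply: sinj; apply: fE.
have [E HE] : exists E : seq (Y t0), forall (M M' : bstruct) (h : M -> Y t0) (h' : M' -> Y t0),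
    countable [set: M] -> countable [set: M'] -> cemb h -> cemb h' -> elemeq M M' ->
    (forall (x : Y t0) k, multP (fun y => ~ exists a, h a = y) x k <->
                       multP (fun y => ~ exists a, h' a = y) x k) ->
    (forall e, List.In e E -> forall k, mult M e k <-> mult M' e k) -> iso M M'.
  apply: finite_invariants => // -[F [Fc FY Finj]]; apply: NM; exists F; split=> // t.
  exact: elemeq_trans (FY t) (YX t0).
(* A multiplicity is [Some q] if it is exactly [q], and [None] if it is infinite; finite lists of
   these are coded by numbers. *)
have /choice[cnt Hcnt] (p : (nat -> bool) * Y t0) : exists o : option nat,
    forall k, mult (M p.1) p.2 k <-> if o is Some q then k <= q else True.
  have [[k0 /mult_max[q [Q0 Q1]]]|N] := pselect (exists k, ~ mult (M p.1) p.2 k).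
    exists (Some q) => k; split=> [Mk|leq]; last exact: multP_le Q0.
    by rewrite leqNgt; apply/negP => ?; apply: Q1; apply: multP_le Mk.
  by exists None => k; split=> // _; apply: contrapT => ?; apply: N; exists k.
exists (fun t => pickle [seq cnt (t, e) | e <- E]) => t u ft fu /(pcan_inj pickleK) Ec.
have emb v : f v = f t0 -> exists g : Y v -> Y t0, cemb g /\ (forall y, exists a, g a = y).
  move=> fv; have : f v t0 by rewrite fv; apply: iso_refl.
  move=> [g [bg gr]]; exists g; split; first exact: iso_cemb.
  by move=> y; case: bg => g' _ gK; exists (g' y).
have [g [gc gs]] := emb t ft; have [g' [gc' gs']] := emb u fu.
apply: Minj; apply: (HE _ _ (g \o oinl (M t) Q) (g' \o oinl (M u) Q)) => //.
- exact: cemb_comp (oinl_cemb _ _) gc.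
- exact: cemb_comp (oinl_cemb _ _) gc'.
- by move=> x k; split; apply: rest_mult.
move=> e eE k; rewrite (Hcnt (t, e)) (Hcnt (u, e)).
suff -> : cnt (t, e) = cnt (u, e) by [].
elim: E Ec eE {HE} => //= a E' IH [Ea /IH {}IH] [<-//|]; exact: IH.
Qed.

(** * Cardinalities of the sets of countable models *)

Lemma inj_surj_bij (A B : Type) (f : A -> B) :
  injective f -> (forall y, exists x, f x = y) -> bijective f.
Proof.
move=> finj /choice[g Hg]; exists g => x; last exact: Hg.
by apply: finj; rewrite Hg.
Qed.

Lemma card_le_injective (T V : Type) : [set: T] #<= [set: V] ->
  exists f : T -> V, injective f.
Proof.
move=> /card_leP[F].
exists (fun x => val (F (exist _ x (mem_setT x)))) => x y /val_inj E.
have := @inj _ _ _ F (exist _ x (mem_setT x)) (exist _ y (mem_setT y)).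
by move=> /(_ (mem_set I) (mem_set I) E) /(congr1 val).
Qed.

Lemma injective_card_le (T V : Type) (f : T -> V) : injective f -> [set: T] #<= [set: V].
Proof.
move=> finj; apply/card_leP.
suff : $|{injfun [set: T] >-> [set: V]}| by move=> [g]; squash (sigLR g).
by apply/injfunPex; exists f => // x y _ _ /finj.
Qed.

Lemma elemeq_infinite (X Y : bstruct) :
  infinite_set [set: X] -> elemeq X Y -> infinite_set [set: Y].
Proof.
move=> Xinf XY [N]; rewrite card_eq_le => /andP[/pcard_leP[f] _].
have flt y : f y < N := @funS _ _ _ _ f y I.
have finj x y : f x = f y -> x = y by apply: (@inj _ _ _ f); rewrite inE.
have [c cinj] := card_le_injective (proj1 (infiniteP _) Xinf).
have [d /code0P Hd] := elemeq_ex 0 N.+1 c XY.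
suff : N.+1 <= N by rewrite ltnn.
apply: (@pigeonhole _ _ (f \o d)) => [i j|_ [i _ <-]]; last exact: flt.
rewrite !inE /= => lti ltj /finj E; apply: cinj.
exact: (proj2 (proj1 (Hd i j lti ltj))).
Qed.

Lemma infinite_inj (X Y : Type) (f : X -> Y) : injective f ->
  infinite_set [set: X] -> infinite_set [set: Y].
Proof.
move=> /injective_card_le XY /infiniteP H; apply/infiniteP; exact: card_le_trans XY.
Qed.

Lemma countable_nat_struct (Y : bstruct) :
  countable [set: Y] -> infinite_set [set: Y] -> exists r, iso Y (nat_struct r).
Proof.
move=> Yc /infiniteP Yinf.
have /pcard_eqP[f] : [set: Y] #= [set: nat] by rewrite card_eq_le; apply/andP.
have finj : injective f by move=> x y; apply: (@inj _ _ _ f); rewrite inE.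
have fsurj n : exists y, f y = n by have [y _ <-] := @surj _ _ _ _ f n I; exists y.
have [g fK gK] := inj_surj_bij finj fsurj.
exists (fun a b => rel_of (g a) (g b)), f; split; first by exists g.
by move=> a b /=; rewrite !fK.
Qed.

Lemma iso_typeE (Y Z : bstruct) : iso Y Z -> iso_type Y = iso_type Z.
Proof.
move=> YZ; apply/seteqP; split=> r /=; apply: iso_trans => //; exact: iso_sym.
Qed.

Lemma iso_type_inj (Y Z : bstruct) : countable [set: Y] -> infinite_set [set: Y] ->
  iso_type Y = iso_type Z -> iso Y Z.
Proof.
move=> Yc Yinf E; have [r Hr] := countable_nat_struct Yc Yinf.
have : iso_type Y r by [].
by rewrite E => /iso_sym; apply: iso_trans.
Qed.

Lemma cmodelsP (X : bstruct) t : cmodels X t <-> infinite_set [set: X] /\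
  exists Y : bstruct, [/\ countable [set: Y], elemeq X Y & t = iso_type Y].
Proof.
by split=> -[Xinf [Y [Yc XY E]]]; split=> //; exists Y; split=> //; apply/modelP.
Qed.

Lemma cmodels_le_continuum (X : bstruct) : cmodels X #<= continuum.
Proof.
have /choice[r Hr] (t : set (nat -> nat -> Prop)) : exists r, cmodels X t ->
    t = iso_type (nat_struct r).
  have [/cmodelsP[Xinf [Y [Yc XY ->]]]|N] := pselect (cmodels X t); last first.
    by exists (fun _ _ => True).
  have [r Hr] := countable_nat_struct Yc (elemeq_infinite Xinf XY).
  by exists r => _; apply: iso_typeE.
pose F t : nat -> bool := fun i =>
  if unpickle i is Some (a, b) then `[< r t a b >] else false.
apply/card_leP; suff : $|{injfun cmodels X >-> continuum}| by move=> [g]; squash (sigLR g).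
apply/injfunPex; exists F => // t u /set_mem Xt /set_mem Xu E.
rewrite (Hr t Xt) (Hr u Xu); congr (iso_type (nat_struct _)).
apply/funext => a; apply/funext => b; apply/propext.
have := congr1 (fun f => f (pickle (a, b))) E; rewrite /F pickleK => Eab.
by split=> h; apply/asboolP; [rewrite -Eab | rewrite Eab]; apply/asboolP.
Qed.

Lemma cmodels_continuum (X : bstruct) :
  cmodels X #= continuum <-> infinite_set [set: X] /\ many_models X.
Proof.
split=> [H|[Xinf [F [Fc FX Finj]]]]; last first.
  rewrite card_eq_le cmodels_le_continuum /=.
  apply/card_leP; suff : $|{injfun continuum >-> cmodels X}| by move=> [g]; squash (sigLR g).
  apply/injfunPex; exists (fun t => iso_type (F t)) => [t _|t u _ _ /iso_type_inj E].
    by apply/cmodelsP; split=> //; exists (F t); split=> //; apply: elemeq_sym.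
  apply: Finj; apply: E => //; apply: elemeq_infinite Xinf _; exact: elemeq_sym.
move: H; rewrite card_eq_sym card_eq_le => /andP[/pcard_leP[f] _].
have fP t : cmodels X (f t) by apply: (@funS _ _ _ _ f t I).
have Xinf : infinite_set [set: X] by case/cmodelsP: (fP (fun=> true)).
split=> //.
have /choice[Y HY] t : exists Y : bstruct, [/\ countable [set: Y], elemeq X Y & f t = iso_type Y].
  by have /cmodelsP[_ [Y HY]] := fP t; exists Y.
exists Y; split=> [t|t|t u /iso_typeE E]; first by case: (HY t).
  by apply: elemeq_sym; case: (HY t).
have ftu : f t = f u by case: (HY t) => _ _ ->; case: (HY u) => _ _ ->.
exact: (@inj _ _ _ f _ _ (mem_set I) (mem_set I) ftu).
Qed.

(** Replacing each [Q j] by a countable elementarily equivalent structure preserves the theory of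
    the sum and makes the models to be counted countable. *)
Lemma cmodels_osum (A : bstruct) (J : Type) (Q : J -> bstruct) (X : bstruct) :
  countable [set: J] -> elemeq (osum A Q) X -> cmodels A #= continuum ->
  cmodels X #= continuum.
Proof.
move=> Jc AX /cmodels_continuum[Ainf [M [Mc MA Minj]]]; apply/cmodels_continuum; split.
  apply: elemeq_infinite AX; apply: infinite_inj Ainf.
  by case: (oinl_cemb A Q) => h _ _; apply: h.
have /choice[Q' HQ'] j : exists Q' : bstruct, countable [set: Q'] /\ elemeq Q' (Q j).
  have [Q' [e [Qc QQ]]] := downward_LS 0 (fun=> pt (Q j)).
  by exists Q'; split=> //; apply: elemeq_of_tpeq QQ.
apply: (@many_osum M J Q') => // [j|t u|t].
- by case: (HQ' j).
- exact: elemeq_trans (MA t) (elemeq_sym (MA u)).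
apply: elemeq_trans AX; apply: osum_elemeq => // j; by case: (HQ' j).
Qed.

(** A finite structure satisfies both sides, so the convention for finite models fits; otherwise
    this is the Ryll-Nardzewski theorem. *)
Lemma cmodels_fintypes (X : bstruct) : cmodels X #<= `I_1 <-> fintypes X.
Proof.
split=> [/pcard_leP[f]|H].
  have [Xfin|Xinf] := pselect (finite_set [set: X]); first exact: fintypes_finite.
  apply: fintypes_unique => Y Z Yc Zc YX ZX.
  have mY : cmodels X (iso_type Y).
    by apply/cmodelsP; split=> //; exists Y; split=> //; apply: elemeq_sym.
  have mZ : cmodels X (iso_type Z).
    by apply/cmodelsP; split=> //; exists Z; split=> //; apply: elemeq_sym.
  apply: iso_type_inj => //; first by apply: elemeq_infinite Xinf _; apply: elemeq_sym.
  have fYZ : f (iso_type Y) = f (iso_type Z).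
    have := @funS _ _ _ _ f _ mY; have := @funS _ _ _ _ f _ mZ.
    by rewrite /= !ltnS !leqn0 => /eqP -> /eqP ->.
  exact: (@inj _ _ _ f _ _ (mem_set mY) (mem_set mZ) fYZ).
apply/card_leP; suff : $|{injfun cmodels X >-> `I_1}| by move=> [g]; squash (sigLR g).
apply/injfunPex; exists (fun=> 0) => // t u /set_mem/cmodelsP[_ [Y [Yc XY ->]]].
move=> /set_mem/cmodelsP[_ [Z [Zc XZ ->]]] _; apply: iso_typeE.
exact: pi_iso Yc Zc (fintypes_pi H (elemeq_sym XY) (elemeq_sym XZ)).
Qed.

Lemma cmodels_le1 (X : bstruct) : cmodels X #<= `I_1 ->
  cmodels X #= `I_0 \/ cmodels X #= `I_1.
Proof.
move=> /pcard_leP[f]; have [[t Xt]|N] := pselect (exists t, cmodels X t).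
  right; suff -> : cmodels X = [set t] by apply: card_set1.
  apply/seteqP; split=> [u Xu|_ -> //].
  have fut : f u = f t.
    have := @funS _ _ _ _ f _ Xt; have := @funS _ _ _ _ f _ Xu.
    by rewrite /= !ltnS !leqn0 => /eqP -> /eqP ->.
  exact: (@inj _ _ _ f _ _ (mem_set Xu) (mem_set Xt) fut).
left; suff -> : cmodels X = set0 by rewrite II0 card_eq00.
by apply/seteqP; split=> // u Xu; case: N; exists u.
Qed.

(** * The closure under products and sums *)

Lemma gsum_rel_tag (I : Type) (i0 : I) (X : I -> bstruct) (a b : gsum i0 X) :
  rel_of a b -> projT1 a = projT1 b.
Proof. by move=> R; apply: (@gsum_conn I i0 X); apply: conn_edge (conn_refl _) _; left. Qed.

Lemma gsum_reindex (I I' : Type) (i0 : I) (i0' : I') (phi : I' -> I) (X : I -> bstruct) :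
  bijective phi -> iso (gsum i0' (X \o phi)) (gsum i0 X).
Proof.
move=> [psi phiK psiK].
pose h (a : gsum i0' (X \o phi)) : gsum i0 X := existT X (phi (projT1 a)) (projT2 a).
exists h; split.
  apply: inj_surj_bij => [[i x] [j y] E|[i x]].
    have ij := can_inj phiK (projT1_eq E); simpl in ij; subst j.
    by congr existT; apply: existT_inj E.
  rewrite -(psiK i) in x *.
  by exists (existT (X \o phi) (psi i) x).
move=> [i x] [j y]; split=> R.
  have /= ij := gsum_rel_tag R; subst j; apply/(gsum_rel i0).
  exact: (proj1 (@gsum_rel _ i0' (X \o phi) i x y) R).
have ij : i = j by apply: (can_inj phiK); apply: (gsum_rel_tag R).
subst j; apply/(@gsum_rel _ _ (X \o phi)); exact: (proj1 (gsum_rel i0 _ _) R).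
Qed.

Lemma gprod_reindex (J J' : Type) (phi : J' -> J) (X : J -> bstruct) :
  bijective phi -> iso (gprod X) (gprod (X \o phi)).
Proof.
move=> [psi phiK psiK]; exists (fun f j => f (phi j)); split; last first.
  by move=> f g; split=> R j; [apply: R | rewrite -(psiK j); apply: R].
apply: inj_surj_bij => [f g E|g].
  apply: functional_extensionality_dep => j; rewrite -(psiK j).
  exact: (congr1 (fun h => h (psi j)) E).
have /dchoice[f Hf] j : exists x : X j, forall i (E : phi i = j), x = eq_rect _ X (g i) j E.
  rewrite -(psiK j); exists (g (psi j)) => i E.
  by have ij := can_inj phiK E; subst i; rewrite (Prop_irrelevance E erefl).
exists f; apply: functional_extensionality_dep => i.
by rewrite (Hf _ i erefl).
Qed.

Lemma gsum_osum (I : eqType) (i1 i0 : I) (X : I -> bstruct) :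
  elemeq (osum (X i0) (fun j : {i | i != i0} => X (val j))) (gsum i1 X).
Proof.
pose phi (o : option {i | i != i0}) := if o is Some j then val j else i0.
have bphi : bijective phi.
  apply: inj_surj_bij => [[j|] [l|]|i] //=.
  - by move/val_inj ->.
  - by case: j => j Hj /= E; exfalso; move: Hj; rewrite E eqxx.
  - by case: l => l Hl /= E; exfalso; move: Hl; rewrite -E eqxx.
  by have [->|N] := eqVneq i i0; [exists None | exists (Some (exist _ i N))].
apply: elemeq_trans (iso_elemeq (gsum_reindex i1 None X bphi)).
by apply: gsum_elemeq => -[j|]; apply: elemeq_refl.
Qed.

Lemma gprod_continuum (K : bstruct -> Prop) (J : finType) (Xs : J -> bstruct) j :
  good_for_products K -> (forall j, K (Xs j)) ->
  cmodels (Xs j) #= continuum -> cmodels (gprod Xs) #= continuum.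
Proof.
move=> K_good K_Xs /cmodels_continuum Hj.
pose phi := @enum_val J predT.
have Jpos : 0 < #|J| by apply/card_gt0P; exists j.
have H : cmodels (bigprod (Xs \o phi)) #= continuum.
  apply: K_good => [//|i|]; first exact: K_Xs.
  exists (enum_rank j); rewrite /= /phi enum_rankK.
  exact/cmodels_continuum.
have E : elemeq (bigprod (Xs \o phi)) (gprod Xs).
  apply: elemeq_sym; apply: iso_elemeq; apply: (gprod_reindex (phi := phi)).
  exact: enum_val_bij.
have [inf [F [Fc FX Finj]]] := proj1 (cmodels_continuum _) H.
apply/cmodels_continuum; split; first exact: elemeq_infinite inf E.
by exists F; split=> // t; apply: elemeq_trans (FX t) E.
Qed.

Section Sums.
Variables (K : bstruct -> Prop) (K_good : good_for_products K).
Variables (I : finType) (i0 : I) (J : I -> finType) (Xs : forall i, J i -> bstruct).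
Arguments Xs : clear implicits.
Variables (K_Xs : forall i j, K (Xs i j)) (X : bstruct).
Hypothesis X_iso : iso X (gsum i0 (fun i => gprod (Xs i))).

Lemma sum_le1 : (forall i j, cmodels (Xs i j) #<= `I_1) -> cmodels X #<= `I_1.
Proof.
move=> H; apply/cmodels_fintypes; apply: fintypes_elemeq (elemeq_sym (iso_elemeq X_iso)) _.
apply: fintypes_gsum => i; apply: fintypes_gprod => j; exact/cmodels_fintypes.
Qed.

Lemma sum_continuum i j : cmodels (Xs i j) #= continuum -> cmodels X #= continuum.
Proof.
move=> /(gprod_continuum K_good (@K_Xs i)); apply: cmodels_osum; last first.
  apply: elemeq_trans (gsum_osum i0 i (fun i => gprod (Xs i))) _.
  exact: elemeq_sym (iso_elemeq X_iso).
exact: countableP.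
Qed.

Lemma sum_VCsharp : (forall Y, K Y -> VCsharp Y) -> VCsharp X.
Proof.
move=> K_VC.
have [[i [j H]]|N] := pselect (exists i j, cmodels (Xs i j) #= continuum).
  by apply: Or33; apply: sum_continuum H.
suff /cmodels_le1[] : cmodels X #<= `I_1 by [exact: Or31 | exact: Or32].
apply: sum_le1 => i j; case: (K_VC _ (K_Xs j)) => [||H].
- by rewrite card_eq_le => /andP[H _]; apply: card_le_trans H _; rewrite card_le_II.
- by rewrite card_eq_le => /andP[].
- by case: N; exists i, j.
Qed.

End Sums.

(** With arbitrary finite index types, the indices for a product or a union are simply pairs or
    tagged sums. *)
Definition normal (K : bstruct -> Prop) (X : bstruct) : Prop :=
  exists (I : finType) (i0 : I) (J : I -> finType) (Xs : forall i, J i -> bstruct),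
    (forall i j, K (Xs i j)) /\ iso X (gsum i0 (fun i => gprod (Xs i))).

(** Products distribute over disjoint unions: the summands of a product are indexed by pairs of
    summands, and the factors of each by the sum of both sets of factors. *)
Lemma generated_normal (K : bstruct -> Prop) X : generated K X -> normal K X.
Proof.
elim=> {X} [X KX
  | X Y _ [I [i0 [J [Xs [KXs [h [hb hr]]]]]]] _ [I' [i0' [J' [Ys [KYs [g [gb gr]]]]]]]
  | X Y _ [I [i0 [J [Xs [KXs [h [hb hr]]]]]]] _ [I' [i0' [J' [Ys [KYs [g [gb gr]]]]]]]
  | X Y XY _ [I [i0 [J [Xs [KXs XI]]]]]].
- exists unit, tt, (fun=> unit), (fun _ _ => X); split=> //.
  pose F := fun _ : unit => gprod (fun _ : unit => X).
  exists (fun x : X => (existT F tt (fun=> x) : gsum tt F)); split.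
    exists (fun a : gsum tt F => (projT2 a : unit -> X) tt) => // -[[] f] /=.
    by congr existT; apply/funext => -[].
  move=> a b; split=> [R|/(@gsum_rel _ tt F) R]; last exact: (R tt).
  exact/(@gsum_rel _ tt F).
- have [h' hK h'K] := hb; have [g' gK g'K] := gb.
  pose JJ (p : I * I') : finType := (J p.1 + J' p.2)%type.
  pose ZZ p (s : JJ p) : bstruct := match s with inl j => Xs p.1 j | inr j => Ys p.2 j end.
  exists (I * I')%type, (i0, i0'), JJ, ZZ.
  split; first by move=> p [j|j]; [apply: KXs | apply: KYs].
  pose mk i i' (f : gprod (Xs i)) (f' : gprod (Ys i')) : gprod (ZZ (i, i')) :=
    fun s => match s return ZZ (i, i') s with inl j => f j | inr j => f' j end.
  pose G := gsum (i0, i0') (fun p => gprod (ZZ p)).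
  pose m (a : gsum i0 (fun i => gprod (Xs i))) (b : gsum i0' (fun i => gprod (Ys i))) : G :=
    existT (fun p => gprod (ZZ p)) (projT1 a, projT1 b) (mk _ _ (projT2 a) (projT2 b)).
  pose w (c : G) : X * Y :=
    (h' (existT (fun i => gprod (Xs i)) (projT1 c).1 (fun j => projT2 c (inl j))),
     g' (existT (fun i => gprod (Ys i)) (projT1 c).2 (fun j => projT2 c (inr j)))).
  exists (fun p : X * Y => m (h p.1) (g p.2)); split.
    exists w => [[x y]|[[i i'] f]].
      rewrite /w /m /=; congr pair; [rewrite -[RHS]hK | rewrite -[RHS]gK].
        by case: (h x).
      by case: (g y).
    rewrite /w /m /= h'K g'K /=; congr existT.
    by apply: functional_extensionality_dep => -[].
  suff key a b c d : rel_of a b /\ rel_of c d <-> @rel_of G (m a c) (m b d).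
    by move=> [x y] [x' y']; rewrite -key -hr -gr.
  case: a b c d => [a fa] [b fb] [c fc] [d fd]; split=> [[Rx Ry]|R].
    have /= ab := gsum_rel_tag Rx; have /= cd := gsum_rel_tag Ry.
    subst b d; apply/(@gsum_rel _ (i0, i0') (fun p => gprod (ZZ p))) => -[j|j] /=.
      exact: (proj1 (@gsum_rel _ i0 (fun i => gprod (Xs i)) _ _ _) Rx j).
    exact: (proj1 (@gsum_rel _ i0' (fun i => gprod (Ys i)) _ _ _) Ry j).
  have /= [ab cd] := gsum_rel_tag R; subst b d.
  have {}R := proj1 (@gsum_rel _ (i0, i0') (fun p => gprod (ZZ p)) _ _ _) R.
  split; first by apply/(@gsum_rel _ i0 (fun i => gprod (Xs i))) => j; exact: (R (inl j)).
  by apply/(@gsum_rel _ i0' (fun i => gprod (Ys i))) => j; exact: (R (inr j)).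
- have [h' hK h'K] := hb; have [g' gK g'K] := gb.
  pose JJ (s : I + I') : finType := match s with inl i => J i | inr i => J' i end.
  pose ZZ s : JJ s -> bstruct :=
    match s return JJ s -> bstruct with inl i => Xs i | inr i => Ys i end.
  exists (I + I')%type, (inl i0), JJ, ZZ; split; first by case.
  pose G := gsum (inl i0) (fun s => gprod (ZZ s)).
  pose m (c : gsum i0 (fun i => gprod (Xs i)) + gsum i0' (fun i => gprod (Ys i))) : G :=
    match c with
    | inl a => existT (fun s => gprod (ZZ s)) (inl (projT1 a)) (projT2 a)
    | inr b => existT (fun s => gprod (ZZ s)) (inr (projT1 b)) (projT2 b)
    end.
  pose w (c : G) : X + Y :=
    match c with
    | existT (inl i) f => inl (h' (existT (fun i => gprod (Xs i)) i f))
    | existT (inr i) f => inr (g' (existT (fun i => gprod (Ys i)) i f))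
    end.
  exists (fun c : X + Y => m (match c with inl x => inl (h x) | inr y => inr (g y) end)); split.
    exists w => [[x|y]|[[i|i] f]] /=.
    - by congr inl; rewrite -[RHS]hK; case: (h x).
    - by congr inr; rewrite -[RHS]gK; case: (g y).
    - by rewrite h'K.
    - by rewrite g'K.
  have keyl a b : rel_of a b <-> @rel_of G (m (inl a)) (m (inl b)).
    case: a b => [a fa] [b fb]; split=> R.
      have /= ab := gsum_rel_tag R; subst b.
      apply/(@gsum_rel _ (inl i0) (fun s => gprod (ZZ s)) (inl a)).
      exact: (proj1 (@gsum_rel _ i0 (fun i => gprod (Xs i)) _ _ _) R).
    have /= [ab] := gsum_rel_tag R; subst b.
    apply/(@gsum_rel _ i0 (fun i => gprod (Xs i))).
    exact: (proj1 (@gsum_rel _ (inl i0) (fun s => gprod (ZZ s)) (inl a) _ _) R).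
  have keyr a b : rel_of a b <-> @rel_of G (m (inr a)) (m (inr b)).
    case: a b => [a fa] [b fb]; split=> R.
      have /= ab := gsum_rel_tag R; subst b.
      apply/(@gsum_rel _ (inl i0) (fun s => gprod (ZZ s)) (inr a)).
      exact: (proj1 (@gsum_rel _ i0' (fun i => gprod (Ys i)) _ _ _) R).
    have /= [ab] := gsum_rel_tag R; subst b.
    apply/(@gsum_rel _ i0' (fun i => gprod (Ys i))).
    exact: (proj1 (@gsum_rel _ (inl i0) (fun s => gprod (ZZ s)) (inr a) _ _) R).
  move=> [x|y] [x'|y'].
  - by rewrite -keyl -hr.
  - by split=> [[]|R]; have := @gsum_rel_tag _ (inl i0) (fun s => gprod (ZZ s)) _ _ R.
  - by split=> [[]|R]; have := @gsum_rel_tag _ (inl i0) (fun s => gprod (ZZ s)) _ _ R.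
  - by rewrite -keyr -gr.
by exists I, i0, J, Xs; split=> //; apply: iso_trans (iso_sym XY) XI.
Qed.

Theorem theorem3p2 (K : bstruct -> Prop)
  (K_connected : forall X, K X -> connected_struct X)
  (K_iso : iso_closed K)
  (K_VC : forall X, K X -> VCsharp X)
  (K_good : good_for_products K) :
  (forall X, generated K X -> VCsharp X) /\
  (forall (n : nat) (n_gt0 : 0 < n) (m : 'I_n -> nat)
     (Xs : forall i : 'I_n, 'I_(m i) -> bstruct) (X : bstruct),
     (forall i, 0 < m i) ->
     (forall i j, K (Xs i j)) ->
     iso X (bigsum n_gt0 (fun i => bigprod (Xs i))) ->
     ((forall i j, cmodels (Xs i j) #<= `I_1) -> cmodels X #<= `I_1) /\
     ((exists i j, cmodels (Xs i j) #= continuum) -> cmodels X #= continuum)).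
Proof.
split=> [X /generated_normal[I [i0 [J [Xs [K_Xs X_iso]]]]]|].
  exact: (sum_VCsharp K_good K_Xs X_iso K_VC).
move=> n n_gt0 m Xs X _ K_Xs X_iso.
have {}X_iso : iso X (gsum (Ordinal n_gt0) (fun i => gprod (Xs i))).
  by apply: iso_trans X_iso _; exists id; split=> //; exists id.
split=> [H|[i [j H]]]; first exact: (sum_le1 X_iso H).
exact: (sum_continuum K_good K_Xs X_iso H).
Qed.
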